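(* If $f$ is a homeomorphism on $X$, there exists a Lyapunov function compactification $(\hat X,\hat f)$ of the cascade $(X,f)$ such that $\hat f$ is a homeomorphism on $\hat X$ and every point of $\hat X\setminus X$ is a fixed point of $\hat f$, that is, $\hat X\setminus X\subset|\hat f|$. If $X$ is metrizable then the compactification $(\hat X,\hat f)$ can be chosen metrizable.
   Context: $X$ is a locally compact, $\sigma$-compact Hausdorff space. A cascade $(X,f)$ is such a space with a continuous map $f:X\to X$ (identified with its graph). $|f|$ is the set of fixed points of $f$. $1_X\subset X\times X$ is the diagonal and $\mathcal Gf$ is the smallest closed transitive relation on $X$ containing $f$. $\mathcal B(X)$ is the Banach algebra of bounded continuous real functions on $X$ with the sup norm. A proper compactification of $X$ is a compact Hausdorff $\hat X$ containing $X$ as a dense (hence open) topological subspace; it corresponds to the closed subalgebra of functions in $\mathcal B(X)$ extending continuously to $\hat X$, and every closed subalgebra (containing the constants) distinguishing points from closed sets arises from a unique (up to homeomorphism) such $\hat X$. $\hat f$ is the closure of $f$ in $\hat X\times\hat X$. A Lyapunov function for $f$ is $L\in\mathcal B(X)$ with $L(x)\le L(f(x))$ for all $x$. With $\le_L=\{(x,y):L(x)\le L(y)\}$, a set $\mathcal L$ of Lyapunov functions is sufficient if $1_X\cup\mathcal Gf=\bigcap_{L\in\mathcal L}\le_L$. A Lyapunov function compactification of $(X,f)$ is the compactification associated with the closed subalgebra generated by a sufficient set of Lyapunov functions together with the continuous functions of compact support. *)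

(* Defs.v *)
From HB Require Import structures.
From mathcomp Require Import all_boot all_order all_algebra.
From mathcomp Require Import all_classical all_reals all_analysis.

Set Implicit Arguments.
Unset Strict Implicit.
Unset Printing Implicit Defensive.

Import Order.TTheory GRing.Theory Num.Theory.
Import numFieldNormedType.Exports.

Local Open Scope classical_set_scope.
Local Open Scope ring_scope.

Definition sigma_compact (X : topologicalType) : Prop :=
  exists K : nat -> set X, (forall n, compact (K n)) /\ \bigcup_n K n = setT.

Definition homeomorphism (X Y : topologicalType) (f : X -> Y) : Prop :=
  continuous f /\
  exists g : Y -> X, [/\ cancel f g, cancel g f & continuous g].

Definition embedding (X Y : topologicalType) (i : X -> Y) : Prop :=
  injective i /\ @open X = [set i @^-1` V | V in @open Y].

Definition metrizable (R : realType) (X : topologicalType) : Prop :=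
  exists (M : metricType R) (h : X -> M), homeomorphism h.

Definition graph (X Y : Type) (f : X -> Y) : set (X * Y) :=
  [set xy | f xy.1 = xy.2].

Definition fixed_points (X : Type) (F : set (X * X)) : set X :=
  [set x | F (x, x)].

Definition closed_transitive (X : topologicalType) (E : set (X * X)) : Prop :=
  closed E /\ (forall x y z, E (x, y) -> E (y, z) -> E (x, z)).

(* The relation Gf. *)
Definition closed_transitive_hull (X : topologicalType) (f : X -> X) :
    set (X * X) :=
  smallest (@closed_transitive X) (graph f).

(* The underlying set of the Banach algebra B(X); its sup-norm topology is the
   one induced from {uniform X -> R}, in which it is closed. *)
Definition bounded_continuous (R : realType) (X : topologicalType) :
    set (X -> R) :=
  [set u | continuous u /\ [bounded u x | x in [set: X]]].

(* Subalgebras are unital: only those correspond to compactifications. *)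
Definition closed_subalgebra (R : realType) (X : topologicalType)
    (A : set (X -> R)) : Prop :=
  [/\ A `<=` @bounded_continuous R X,
      A (cst 1),
      forall (a : R) (u v : X -> R),
        A u -> A v -> A (fun x => a * u x + v x),
      forall u v : X -> R, A u -> A v -> A (fun x => u x * v x) &
      closed (A : set {uniform X -> R})].

Definition generated_closed_subalgebra (R : realType) (X : topologicalType)
    (S : set (X -> R)) : set (X -> R) :=
  smallest (@closed_subalgebra R X) S.

Definition compactly_supported (R : realType) (X : topologicalType) :
    set (X -> R) :=
  [set u | continuous u /\ compact (closure [set x | u x != 0])].

Definition lyapunov (R : realType) (X : topologicalType) (f : X -> X) :
    set (X -> R) :=
  [set L | bounded_continuous L /\ forall x, L x <= L (f x)].

Definition sufficient (R : realType) (X : topologicalType) (f : X -> X)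
    (Ls : set (X -> R)) : Prop :=
  Ls `<=` @lyapunov R X f /\
  diagonal `|` closed_transitive_hull f =
    \bigcap_(L in Ls) [set xy : X * X | L xy.1 <= L xy.2].

(* The inclusion of X in its compactification is an arbitrary dense embedding
   i : X -> Xh. *)
Definition proper_compactification (X Xh : topologicalType) (i : X -> Xh) :
    Prop :=
  [/\ compact [set: Xh], hausdorff_space Xh, embedding i & dense (range i)].

Definition extendable (R : realType) (X Xh : topologicalType) (i : X -> Xh) :
    set (X -> R) :=
  [set u | bounded_continuous u /\
           exists2 v : Xh -> R, continuous v & forall x, v (i x) = u x].

Definition lyapunov_compactification (R : realType) (X : topologicalType)
    (f : X -> X) (Xh : topologicalType) (i : X -> Xh) : Prop :=
  proper_compactification i /\
  exists2 Ls : set (X -> R), sufficient f Ls &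
    extendable i =
      generated_closed_subalgebra (Ls `|` @compactly_supported R X).

(* The relation induced by f on Xh: the closure of f in Xh * Xh. *)
Definition extended_relation (X : topologicalType) (f : X -> X)
    (Xh : topologicalType) (i : X -> Xh) : set (Xh * Xh) :=
  closure [set (i xy.1, i xy.2) | xy in graph f].

Definition homeomorphism_relation (X : topologicalType) (F : set (X * X)) :
    Prop :=
  exists2 g : X -> X, homeomorphism g & F = graph g.

(* Main.v *)
(** The point is to find Lyapunov functions [L] separating [(x, y)] outside
    [1_X] and [Gf] with [L o f - L] vanishing at infinity: the functions [u]
    with [u o f - u] vanishing at infinity form a closed subalgebra, so in the
    compactification the extension of [f] fixes every boundary point.

    Since [1_X u Gf] is a closed preorder on a sigma-compact locally compact
    space, it is normal, and a monotone Urysohn argument yields a monotone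
    [L : X -> [0, 1]] with [L x = 1] and [L y = 0].  Choose a continuous
    [eps : X -> (0, 1]] vanishing at infinity, equal to 1 at [y], and decaying so
    slowly (at least [1 / (n + 1)] on the n-th member of an exhaustion that [f]
    shifts by at most one step) that stopping the orbit of a point at each [z]
    with probability [eps z] stops it almost surely, locally uniformly.  The
    expected value [L'] of [L] at the stopping time is continuous and satisfies
    [L' z = eps z * L z + (1 - eps z) * L' (f z)], so
    [0 <= L' o f - L' <= eps], while [L' x >= L x = 1] and [L' y = L y = 0].

    In the metrizable case countably many such functions suffice; together with
    countably many functions of compact support separating the points of [X],
    they separate the points of the compactification. *)

Require Import Defs.
From HB Require Import structures.
From mathcomp Require Import all_boot all_order all_algebra.
From mathcomp Require Import all_classical all_reals all_analysis.
From mathcomp Require Import ring lra.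

Set Implicit Arguments.
Unset Strict Implicit.
Unset Printing Implicit Defensive.

Import Order.TTheory GRing.Theory Num.Theory.
Import numFieldNormedType.Exports.

Local Open Scope classical_set_scope.
Local Open Scope ring_scope.

(** * Exhaustions of locally compact spaces *)

Section LocallyCompact.
Context {X : topologicalType}.

(** Induction over compact sets, used in place of finite subcovers. If [P K] failed, the sets whose
    complement in [K] satisfies [P] would form a proper filter containing [K]; at a cluster point in
    [K], the complement of a neighbourhood satisfying [P] belongs to this filter, which is
    absurd. *)
Lemma compact_union_ind (K : set X) (P : set X -> Prop) :
  compact K -> P set0 -> (forall A B, P A -> P B -> P (A `|` B)) ->
  (forall A B, A `<=` B -> P B -> P A) ->
  (forall x, K x -> exists2 U, nbhs x U & P U) -> P K.
Proof.
move=> cK P0 PU PS Ploc; apply: contrapT => nPK.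
pose F : set_system X := [set S | P (K `\` S)].
have FF : ProperFilter F.
  split; first by rewrite /F /= setD0.
  split; first by rewrite /F /= setDT.
    by move=> A B FA FB; rewrite /F /= setDIr; exact: PU.
  by move=> A B AB; apply: PS; exact: setDS.
have [|x [Kx clx]] := cK F FF; first by rewrite /F /= setDv.
have [U Ux PUx] := Ploc x Kx.
have FU : F (~` U) by rewrite /F /= setDE setCK; apply: PS PUx; exact: subIsetr.
by have [y []] := clx _ _ FU Ux.
Qed.

Hypothesis lcX : locally_compact [set: X].
Hypothesis hsX : hausdorff_space X.

(** Regularity of a compact Hausdorff neighbourhood turns the one compact neighbourhood given by
    local compactness into arbitrarily small ones. *)
Lemma compact_nbhs_sub (x : X) (U : set X) :
  nbhs x U -> exists2 W, nbhs x W & compact W /\ W `<=` U.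
Proof.
move=> xU; have [V Vx [cV clV]] := lcX (x := x) I.
have {}Vx : nbhs x V by move: Vx; rewrite /within /=; apply: filterS => y;
  exact.
have [B Bx BU] := compact_regular hsX cV Vx xU.
exists (closure B `&` V).
  by apply: filterI => //; apply: filterS Bx; exact: subset_closure.
split; last by move=> y [/BU].
by rewrite setIC; apply: compact_closedI => //; exact: closed_closure.
Qed.

Lemma compact_compact_nbhs (K : set X) :
  compact K -> exists2 W, compact W & K `<=` W°.
Proof.
move=> cK; apply: (compact_union_ind (P := fun A =>
  exists2 W, compact W & A `<=` W°)) => //.
- by exists set0 => //; exact: compact0.
- move=> A B [V cV AV] [W cW BW]; exists (V `|` W); first exact: compactU.
  move=> x [/AV|/BW]; apply: filterS => y ?; [by left|by right].
- by move=> A B AB [W cW BW]; exists W => //; exact: subset_trans BW.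
- move=> x _; have [W xW [cW _]] := compact_nbhs_sub (filterT : nbhs x setT).
  by exists (W°); [exact: nbhs_interior|exists W].
Qed.

Definition exhaustion (K : nat -> set X) :=
  [/\ forall n, compact (K n), forall n, K n `<=` (K n.+1)° &
      \bigcup_n K n = setT].

(** Each term is a compact neighbourhood of the previous term, of its image under [f] and of one
    more piece of the sigma-compact cover. Control of the images bounds how fast orbits escape to
    infinity. *)
Lemma exhaustion_exists (f : X -> X) : sigma_compact X -> continuous f ->
  exists2 K, exhaustion K & forall n, f @` K n `<=` K n.+1.
Proof.
move=> [J [cJ JT]] cf.
have /choice[N NP] : forall A : set X, exists W, compact A ->
  compact W /\ A `<=` W°.
  move=> A; case: (pselect (compact A)) => [/compact_compact_nbhs [W ? ?]|nA].
    by exists W.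
  by exists A.
pose K := fix K n := if n is m.+1 then N (K m `|` (f @` K m) `|` J m) else set0.
have cfK A : compact A -> compact (f @` A).
  by move=> cA; apply: continuous_compact => //; exact: continuous_subspaceT.
have cK n : compact (K n).
  elim: n => [|n IH]; first exact: compact0.
  have /NP[] // : compact (K n `|` (f @` K n) `|` J n).
  by apply: compactU => //; apply: compactU => //; exact: cfK.
have sK n : K n `|` (f @` K n) `|` J n `<=` (K n.+1)°.
  have /NP[] // : compact (K n `|` (f @` K n) `|` J n).
  by apply: compactU => //; apply: compactU => //; exact: cfK.
exists K.
  split => //; first by move=> n x Kx; apply: sK; left; left.
  rewrite -subTset -JT => x [n _ Jx]; exists n.+1 => //.
  by apply: interior_subset; apply: sK; right.
by move=> n x fx; apply: interior_subset; apply: sK; left; right.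
Qed.

Lemma exhaustion_mono (K : nat -> set X) : exhaustion K ->
  forall m n, (m <= n)%N -> K m `<=` K n.
Proof.
move=> [_ sK _] m n /subnKC <-; elim: (n - m)%N => [|k IH]; rewrite ?addn0//.
rewrite addnS; apply: subset_trans IH _ => x /sK.
exact: interior_subset.
Qed.

Lemma exhaustion_compact (K : nat -> set X) : exhaustion K ->
  forall A, compact A -> exists n, A `<=` K n.
Proof.
move=> eK A cA; have [cK sK KT] := eK.
apply: (compact_union_ind (P := fun A => exists n, A `<=` K n)) => //.
- by exists 0%N.
- move=> B C [m Bm] [n Cn]; exists (maxn m n) => x [/Bm|/Cn].
    by apply: exhaustion_mono => //; exact: leq_maxl.
  by apply: exhaustion_mono => //; exact: leq_maxr.
- by move=> B C BC [n Cn]; exists n; exact: subset_trans Cn.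
- move=> x _; have [n _ Kx] : (\bigcup_n K n) x by rewrite KT.
  by exists (K n.+1); [exact: sK|exists n.+1].
Qed.

End LocallyCompact.

(** * Normality of closed preorders *)

Section ClosedPreorder.
Context {X : topologicalType} (le : set (X * X)).
Hypothesis lcX : locally_compact [set: X].
Hypothesis hsX : hausdorff_space X.
Hypothesis le_closed : closed le.
Hypothesis le_refl : forall x, le (x, x).
Hypothesis le_trans : forall x y z, le (x, y) -> le (y, z) -> le (x, z).

Definition upset (C : set X) := forall x y, C x -> le (x, y) -> C y.
Definition downset (C : set X) := forall x y, C y -> le (x, y) -> C x.
Definition upclosure (A : set X) := [set y | exists2 x, A x & le (x, y)].
Definition downclosure (A : set X) := [set x | exists2 y, A y & le (x, y)].

Lemma sub_upclosure A : A `<=` upclosure A.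
Proof. by move=> x Ax; exists x. Qed.

Lemma sub_downclosure A : A `<=` downclosure A.
Proof. by move=> x Ax; exists x. Qed.

Lemma not_le_near x y : ~ le (x, y) ->
  exists2 UV : set X * set X, nbhs x UV.1 /\ nbhs y UV.2 &
    forall a b, UV.1 a -> UV.2 b -> ~ le (a, b).
Proof.
move=> nxy; have : nbhs (x, y) (~` le).
  by apply: open_nbhs_nbhs; split => //; exact: closed_openC.
move=> [[U V] /= [Ux Vy] UV]; exists (U, V) => // a b Ua Vb.
by apply: (UV (a, b)).
Qed.

(** If [y] lies above no point of [A], each pair [(x, y)] with [x] in [A] has a neighbourhood off
    [le], and compactness of [A] makes the neighbourhood of [y] uniform in [x]. *)
Lemma upclosure_closed A : compact A -> closed (upclosure A).
Proof.
move=> cA; rewrite -openC openE => y nAy.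
have H : \forall y' \near y, A `<=` [set x | ~ le (x, y')].
  apply: (iffLR (compact_near_coveringP A)) => // x Ax.
  have /not_le_near[[U V] /= [Ux Vy] UV] : ~ le (x, y).
    by move=> xy; apply: nAy; exists x.
  by exists (U, V) => // -[a b] /= [Ua Vb]; exact: UV.
by apply: filterS H => z Az [x Ax xz]; exact: (Az x).
Qed.

Lemma downclosure_closed A : compact A -> closed (downclosure A).
Proof.
move=> cA; rewrite -openC openE => y nAy.
have H : \forall y' \near y, A `<=` [set x | ~ le (y', x)].
  apply: (iffLR (compact_near_coveringP A)) => // x Ax.
  have /not_le_near[[U V] /= [Uy Vx] UV] : ~ le (y, x).
    by move=> xy; apply: nAy; exists x.
  by exists (V, U) => // -[a b] /= [Va Ub]; exact: UV.
by apply: filterS H => z Az [x Ax xz]; exact: (Az x).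
Qed.

Definition unrelated (A B : set X) := forall a b, A a -> B b -> ~ le (a, b).

(** Compactness induction on [B] and then on [A] reduces to two points, where closedness of [le]
    gives neighbourhoods and local compactness shrinks them to compact ones. *)
Lemma compact_unrelated_nbhs A B : compact A -> compact B -> unrelated A B ->
  exists2 UV : set X * set X, compact UV.1 /\ compact UV.2 &
    [/\ A `<=` UV.1°, B `<=` UV.2° & unrelated UV.1 UV.2].
Proof.
move=> cA cB.
pose sep (S T : set X) := exists2 UV : set X * set X,
  compact UV.1 /\ compact UV.2 &
  [/\ S `<=` UV.1°, T `<=` UV.2° & unrelated UV.1 UV.2].
have sepU S S' T : sep S T -> sep S' T -> sep (S `|` S') T.
  move=> [[U V] /= [cU cV] [SU TV UV]] [[U' V'] /= [cU' cV'] [SU' TV' UV']].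
  exists (U `|` U', V `&` V') => /=; split.
  - exact: compactU.
  - by apply: compact_closedI => //; exact: compact_closed.
  - by move=> x [/SU|/SU']; apply: filterS => y ?; [left|right].
  - by move=> x Tx; apply: filterI; [exact: TV|exact: TV'].
  - by move=> x y [Ux|Ux] [Vy V'y]; [exact: UV|exact: UV'].
have sepUr S T T' : sep S T -> sep S T' -> sep S (T `|` T').
  move=> [[U V] /= [cU cV] [SU TV UV]] [[U' V'] /= [cU' cV'] [SU' TV' UV']].
  exists (U `&` U', V `|` V') => /=; split.
  - by apply: compact_closedI => //; exact: compact_closed.
  - exact: compactU.
  - by move=> x Tx; apply: filterI; [exact: SU|exact: SU'].
  - by move=> x [/TV|/TV']; apply: filterS => y ?; [left|right].
  - by move=> x y [Ux U'x] [Vy|Vy]; [exact: UV|exact: UV'].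
have sepS S S' T T' : S `<=` S' -> T `<=` T' -> sep S' T' -> sep S T.
  move=> SS TT [[U V] /= UVc [SU TV UV]]; exists (U, V) => //; split => //=.
    exact: subset_trans SU.
  exact: subset_trans TV.
have sep0 T : compact T -> sep set0 T.
  move=> cT; have [W cW TW] := compact_compact_nbhs lcX hsX cT.
  by exists (set0, W); split => //; exact: compact0.
have sep0r T : compact T -> sep T set0.
  move=> cT; have [W cW TW] := compact_compact_nbhs lcX hsX cT.
  by exists (W, set0); split => //; exact: compact0.
move=> AB; apply: (compact_union_ind (P := sep A)) => //.
- exact: sep0r.
- by move=> S T; exact: sepUr.
- by move=> S T ST; exact: sepS.
move=> b Bb.
(* A separation of [A] from [b] already separates [A] from the whole neighbourhood [V°] of [b]. *)
suff [[U V] /= UVc [AU bV UV]] : sep A [set b].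
  exists (V°); first by apply: nbhs_interior; exact: bV.
  by exists (U, V) => //; split.
apply: (compact_union_ind (P := sep^~ [set b])) => //.
- by apply: sep0; exact: compact_set1.
- by move=> S T ? ?; exact: sepU.
- by move=> S T ST; exact: sepS.
move=> a Aa; have [[U V] /= [Ua Vb] UV] := not_le_near (AB _ _ Aa Bb).
have [U' U'a [cU' U'U]] := compact_nbhs_sub lcX hsX Ua.
have [V' V'b [cV' V'V]] := compact_nbhs_sub lcX hsX Vb.
exists (U'°); first exact: nbhs_interior.
exists (U', V') => //=; split => //; first by move=> _ ->.
by move=> x y /U'U Ux /V'V; exact: UV.
Qed.

Section Normal.
Context (K : nat -> set X).
Hypothesis eK : exhaustion K.

(* The trace of the separation on [K n]; saturating inside [K n.+1] at each
   step makes the increasing unions an open upset and an open downset. *)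
Definition partial_separation (C0 D0 : set X) n (CD : set X * set X) :=
  [/\ compact CD.1 /\ compact CD.2, CD.1 `|` CD.2 `<=` K n,
      unrelated CD.1 CD.2, C0 `&` K n `<=` CD.1 & D0 `&` K n `<=` CD.2].

(** The old sets, enlarged by the traces of [C0] and [D0] on [K n.+1], are still unrelated. They
    have unrelated compact neighbourhoods, whose saturations inside [K n.+1] are the new sets. *)
Lemma partial_separation_extend C0 D0 n CD :
  closed C0 -> closed D0 -> upset C0 -> downset D0 -> C0 `&` D0 = set0 ->
  partial_separation C0 D0 n CD ->
  exists2 CD', partial_separation C0 D0 n.+1 CD' &
    [/\ CD.1 `<=` CD'.1°, CD.2 `<=` CD'.2°,
        forall x y, CD.1 x -> le (x, y) -> K n.+1 y -> CD'.1 y &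
        forall x y, CD.2 y -> le (x, y) -> K n.+1 x -> CD'.2 x].
Proof.
move=> clC clD uC dD CD0; case: CD => C D [] /= [cC cD] CDK nCD CK DK.
have [cK sK KT] := eK.
have [] := @compact_unrelated_nbhs (C `|` (K n.+1 `&` C0)) (D `|` (K n.+1 `&`
  D0)).
- by apply: compactU => //; exact: compact_closedI.
- by apply: compactU => //; exact: compact_closedI.
(* In the second case [c] inherits membership in [D0] from [d]; as it lies in [K n], it is in both
   [C] and [D], against reflexivity. The third case is dual. *)
- move=> c d [Cc|[Kc Cc]] [Dd|[Kd Dd]] cd.
  + exact: (nCD c d).
  + apply: (nCD c c) => //; apply: DK; split; first exact: dD cd.
    by apply: CDK; left.
  + apply: (nCD d d) => //; apply: CK; split; first exact: uC cd.
    by apply: CDK; right.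
  + have : (C0 `&` D0) c by split => //; exact: dD cd.
    by rewrite CD0.
move=> [U V] /= [cU cV] [CU DV UV].
have KI x : K n x -> nbhs x (K n.+1) by move/sK.
exists (K n.+1 `&` upclosure U, K n.+1 `&` downclosure V) => /=; split => /=.
- split; apply: compact_closedI => //; first exact: upclosure_closed.
  exact: downclosure_closed.
- by move=> x [] [].
- move=> c d [_ [x Ux xc]] [_ [y Vy dy]] cd.
  by apply: (UV x y) => //; apply: le_trans dy; exact: le_trans cd.
- move=> x [Cx Kx]; split => //; apply: sub_upclosure; apply: interior_subset.
  by apply: CU; right.
- move=> x [Cx Kx]; split => //; apply: sub_downclosure; apply: interior_subset.
  by apply: DV; right.
- move=> x Cx; apply: filterI; first by apply: KI; apply: CDK; left.
  by apply: filterS (CU x _); [exact: sub_upclosure|left].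
- move=> x Dx; apply: filterI; first by apply: KI; apply: CDK; right.
  by apply: filterS (DV x _); [exact: sub_downclosure|left].
- move=> x y Cx xy Ky; split => //; exists x => //; apply: interior_subset.
  by apply: CU; left.
- move=> x y Cx xy Ky; split => //; exists y => //; apply: interior_subset.
  by apply: DV; left.
Qed.

(** The separating sets are the unions of a chain of partial separations. Each stage lies in the
    interior of the next, which makes the unions open. *)
Lemma preorder_normal C D :
  closed C -> closed D -> upset C -> downset D -> C `&` D = set0 ->
  exists2 UV : set X * set X,
    [/\ open UV.1, upset UV.1, open UV.2 & downset UV.2] &
    [/\ C `<=` UV.1, D `<=` UV.2 & UV.1 `&` UV.2 = set0].
Proof.
move=> clC clD uC dD CD0; have [cK sK KT] := eK.
pose ext n (p q : set X * set X) := partial_separation C D n p ->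
  partial_separation C D n.+1 q /\ [/\ p.1 `<=` q.1°, p.2 `<=` q.2°,
    forall x y, p.1 x -> le (x, y) -> K n.+1 y -> q.1 y &
    forall x y, p.2 y -> le (x, y) -> K n.+1 x -> q.2 x].
have /choice[g gP] : forall np : nat * (set X * set X), exists q,
  ext np.1 np.2 q.
  move=> [n p] /=; have [pp|np] := pselect (partial_separation C D n p).
    by have [q ? ?] := partial_separation_extend clC clD uC dD CD0 pp; exists q.
  by exists p.
pose s := fix s n := if n is m.+1 then g (m, s m) else (K 0%N `&` C,
  K 0%N `&` D).
have sP n : partial_separation C D n (s n).
  elim: n => [|n IH]; last by have [] := gP (n, s n) IH.
  split => /=; first by split; exact: compact_closedI.
  - by move=> x [] [].
  - move=> c d [_ Cc] [_ Dd] cd.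
    have : (C `&` D) c by split => //; exact: dD cd.
    by rewrite CD0.
  - by move=> x [].
  - by move=> x [].
have sS n : [/\ (s n).1 `<=` (s n.+1).1°, (s n).2 `<=` (s n.+1).2°,
    forall x y, (s n).1 x -> le (x, y) -> K n.+1 y -> (s n.+1).1 y &
    forall x y, (s n).2 y -> le (x, y) -> K n.+1 x -> (s n.+1).2 x].
  by have [] := gP (n, s n) (sP n).
have mono1 m n : (m <= n)%N -> (s m).1 `<=` (s n).1.
  move=> /subnKC <-; elim: (n - m)%N => [|k IH]; rewrite ?addn0 ?addnS//.
  move=> x /IH xs; apply: interior_subset; by have [+ _ _ _] := sS (m + k)%N;
    apply.
have mono2 m n : (m <= n)%N -> (s m).2 `<=` (s n).2.
  move=> /subnKC <-; elim: (n - m)%N => [|k IH]; rewrite ?addn0 ?addnS//.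
  move=> x /IH xs; apply: interior_subset; by have [_ + _ _] := sS (m + k)%N;
    apply.
have Kmax m n x : K m x -> K (maxn m n).+1 x.
  by apply: exhaustion_mono => //; rewrite leqW// leq_maxl.
exists (\bigcup_n (s n).1, \bigcup_n (s n).2); split => /=.
- rewrite openE => x [n _ xs]; have [+ _ _ _] := sS n => /(_ _ xs).
  by apply: filterS => y ys; exists n.+1.
- move=> x y [n _ xs] xy.
  have [m _ Ky] : (\bigcup_n K n) y by rewrite KT.
  (* Stage [maxn m n] contains [x], and the next stage is saturated inside a set that contains
     [y]. *)
  exists (maxn m n).+1 => //.
  have [_ _ + _] := sS (maxn m n); apply; last exact: Kmax.
    by apply: mono1 xs; exact: leq_maxr.
  by [].
- rewrite openE => x [n _ xs]; have [_ + _ _] := sS n => /(_ _ xs).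
  by apply: filterS => y ys; exists n.+1.
- move=> x y [n _ xs] xy.
  have [m _ Ky] : (\bigcup_n K n) x by rewrite KT.
  exists (maxn m n).+1 => //.
  have [_ _ _ +] := sS (maxn m n); apply; last exact: Kmax.
    by apply: mono2 xs; exact: leq_maxr.
  by [].
- move=> x Cx; have [m _ Kx] : (\bigcup_n K n) x by rewrite KT.
  by exists m => //; have [_ _ _ + _] := sP m; apply.
- move=> x Cx; have [m _ Kx] : (\bigcup_n K n) x by rewrite KT.
  by exists m => //; have [_ _ _ _ +] := sP m; apply.
- apply/seteqP; split => // x [[m _ xm] [n _ xn]].
  have [_ _ + _ _] := sP (maxn m n); move=> /(_ x x); apply => //.
    by apply: mono1 xm; exact: leq_maxl.
  by apply: mono2 xn; exact: leq_maxr.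
Qed.

End Normal.
End ClosedPreorder.

(** * Monotone Urysohn functions *)

Lemma nbhs_norm_continuous {R : realType} {X : topologicalType} (u : X -> R) :
  (forall x e, 0 < e -> \forall y \near x, `|u y - u x| <= e) -> continuous u.
Proof.
move=> H x; apply/cvgrPdist_le => e e0.
by apply: filterS (H x e e0) => y; rewrite distrC.
Qed.

Section MonotoneUrysohn.
Context {R : realType} {X : topologicalType} (le : set (X * X)).

(** The function attached to such a pair will be 1 on [s.1] and 0 off [s.2]; asking for upsets makes
    it monotone. *)
Definition nested (s : set X * set X) :=
  [/\ closed s.1, upset le s.1, open s.2, upset le s.2 & s.1 `<=` s.2].

Context (split : set X * set X -> set X * set X).
Hypothesis splitP : forall s, nested s ->
  nested (s.1, (split s).1) /\ nested ((split s).2, s.2).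
Hypothesis split_sub : forall s, nested s -> (split s).1 `<=` (split s).2.

Let lower (s : set X * set X) := (s.1, (split s).1).
Let upper (s : set X * set X) := ((split s).2, s.2).

(** A recursive form of the dyadic Urysohn construction: [split] inserts an open upset inside a
    closed upset between the two members of the pair, and the function is the mean of those of the
    two resulting pairs. *)
Fixpoint urysohn_approx n s : X -> R := if n is m.+1
  then fun x => (urysohn_approx m (lower s) x + urysohn_approx m (upper s) x) /
    2
  else \1_(s.1).

Definition urysohn_limit s x := lim (urysohn_approx n s x @[n --> \oo]).

Lemma urysohn_approx_itv n s x : 0 <= urysohn_approx n s x <= 1.
Proof.
elim: n s => [s|n IH s] /=.
  by rewrite indicE; case: (_ \in _); rewrite ?lexx ler01.
have := IH (lower s); have := IH (upper s); lra.
Qed.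

Lemma urysohn_approx1 n s x : nested s -> s.1 x -> urysohn_approx n s x = 1.
Proof.
elim: n s => [s|n IH s] /=; first by move=> _ sx; rewrite indicE mem_set.
move=> ns sx; have [nl nu] := splitP ns; rewrite !IH//; first lra.
by apply: (split_sub ns); case: nl => _ _ _ _ /=; apply.
Qed.

Lemma urysohn_approx0 n s x : nested s -> ~ s.2 x -> urysohn_approx n s x = 0.
Proof.
elim: n s => [s|n IH s] /=.
  by move=> [_ _ _ _ s12] sx; rewrite indicE memNset// => /s12.
move=> ns sx; have [nl nu] := splitP ns; rewrite !IH//; first lra.
move=> /(split_sub ns) x2; apply: sx; case: nu => _ _ _ _ /=; exact.
Qed.

Lemma urysohn_approx_mono n s x y : nested s -> le (x, y) ->
  urysohn_approx n s x <= urysohn_approx n s y.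
Proof.
move=> + xy; elim: n s => [s|n IH s] /= ns; last first.
  by have [nl nu] := splitP ns; have := IH _ nl; have := IH _ nu;
    rewrite /upper /lower; lra.
rewrite !indicE; have [sx|sx] := boolP (x \in s.1); last by rewrite ler0n.
rewrite mem_set//; case: ns => _ us _ _ _; apply: us xy; exact: set_mem.
Qed.

(** Averaging preserves the inequality, so only the first step matters: on [s.1] both values are 1,
    elsewhere the indicator is 0. *)
Lemma urysohn_approx_ndecr s x : nested s ->
  nondecreasing_seq (fun n => urysohn_approx n s x).
Proof.
move=> ns; apply/nondecreasing_seqP => n; elim: n s ns => [s ns|n IH s ns].
  have [sx|sx] := pselect (s.1 x); first by rewrite !urysohn_approx1.
  have /andP[+ _] := urysohn_approx_itv 1 s x.
  by rewrite [urysohn_approx 0 s x]indicE memNset.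
have [/IH nl /IH nu] := splitP ns.
suff step m : urysohn_approx m.+1 s x =
    (urysohn_approx m (lower s) x + urysohn_approx m (upper s) x) / 2.
  by rewrite !step; move: nl nu; rewrite /lower /upper; lra.
by [].
Qed.

Lemma urysohn_limit_cvg s x : nested s ->
  urysohn_approx n s x @[n --> \oo] --> urysohn_limit s x.
Proof.
move=> ns; apply: nondecreasing_is_cvgn; first exact: urysohn_approx_ndecr.
by exists 1 => _ [n _ <-]; have /andP[] := urysohn_approx_itv n s x.
Qed.

(** The self-similarity of the limit, on which every local estimate below relies. *)
Lemma urysohn_limit_split s x : nested s ->
  urysohn_limit s x = (urysohn_limit (lower s) x + urysohn_limit (upper s) x) /
    2.
Proof.
move=> ns; have [nl nu] := splitP ns; apply: cvg_lim => //.
rewrite -cvg_shiftS /=.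
apply: cvgM; last exact: cvg_cst.
by apply: cvgD; exact: urysohn_limit_cvg.
Qed.

Lemma urysohn_limit_itv s x : nested s -> 0 <= urysohn_limit s x <= 1.
Proof.
move=> ns; have c := urysohn_limit_cvg ns (x := x); apply/andP; split.
  by apply: limr_ge; [exact: cvgP c|apply: nearW => n;
    have /andP[] := urysohn_approx_itv n s x].
by apply: limr_le; [exact: cvgP c|apply: nearW => n;
  have /andP[] := urysohn_approx_itv n s x].
Qed.

Lemma urysohn_limit1 s x : nested s -> s.1 x -> urysohn_limit s x = 1.
Proof.
move=> ns sx; apply: cvg_lim => //.
by under eq_fun do rewrite urysohn_approx1//; exact: cvg_cst.
Qed.

Lemma urysohn_limit0 s x : nested s -> ~ s.2 x -> urysohn_limit s x = 0.
Proof.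
move=> ns sx; apply: cvg_lim => //.
by under eq_fun do rewrite urysohn_approx0//; exact: cvg_cst.
Qed.

Lemma urysohn_limit_mono s x y : nested s -> le (x, y) ->
  urysohn_limit s x <= urysohn_limit s y.
Proof.
move=> ns xy; apply: ler_lim.
- exact: cvgP (urysohn_limit_cvg ns).
- exact: cvgP (urysohn_limit_cvg ns).
- by apply: nearW => n; exact: urysohn_approx_mono.
Qed.

(** Near [x] one stays off the closed set [(split s).2], where the lower half is 0; so each level of
    splitting halves the bound. *)
Lemma urysohn_limit_near0 n s x : nested s -> ~ s.2 x ->
  \forall y \near x, urysohn_limit s y <= 2^-1 ^+ n.
Proof.
elim: n s => [s ns _|n IH s ns sx].
  by apply: nearW => y; have := urysohn_limit_itv y ns; rewrite expr0; lra.
have [nl nu] := splitP ns.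
have x2 : ~ (split s).2 x by move=> x2; apply: sx; case: nu => _ _ _ _; exact.
have : nbhs x (~` (split s).2).
  by apply: open_nbhs_nbhs; split=> //; apply: closed_openC; case: nu.
apply: filterS2 (IH _ nu sx) => y uy ny.
have l0 : urysohn_limit (lower s) y = 0.
  by apply: (urysohn_limit0 nl) => /(split_sub ns).
by rewrite urysohn_limit_split// exprS l0; move: uy; rewrite /upper; lra.
Qed.

(** Near [x] one stays in the open set [(split s).1], where the upper half is 1; the distance to 1
    is halved at each level. *)
Lemma urysohn_limit_near1 n s x : nested s -> s.1 x ->
  \forall y \near x, 1 - 2^-1 ^+ n <= urysohn_limit s y.
Proof.
elim: n s => [s ns _|n IH s ns sx].
  by apply: nearW => y; have := urysohn_limit_itv y ns; rewrite expr0; lra.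
have [nl nu] := splitP ns.
have x1 : (split s).1 x by case: nl => _ _ _ _ /=; apply.
have : nbhs x (split s).1 by apply: open_nbhs_nbhs; split=> //; case: nl.
apply: filterS2 (IH _ nl sx) => y uy ny.
have u1 : urysohn_limit (upper s) y = 1.
  by apply: (urysohn_limit1 nu); exact: (split_sub ns).
by rewrite urysohn_limit_split// exprS u1; move: uy; rewrite /lower; lra.
Qed.

(* Near a point of [(split s).1] or off [(split s).2] one half of the average is
   locally constant, which halves the oscillation; at the remaining points the
   lower half is close to 0 and the upper half close to 1. *)
Lemma urysohn_limit_osc n s x : nested s ->
  \forall y \near x, `|urysohn_limit s y - urysohn_limit s x| <= 2^-1 ^+ n.
Proof.
elim: n s => [s ns|n IH s ns].
  apply: nearW => y; rewrite expr0 ler_norml.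
  have := urysohn_limit_itv x ns; have := urysohn_limit_itv y ns; lra.
have [nl nu] := splitP ns.
have [x1|x1] := pselect ((split s).1 x).
  have : nbhs x (split s).1 by apply: open_nbhs_nbhs; split=> //; case: nl.
  apply: filterS2 (IH _ nl) => y ly y1.
  have u1 z : (split s).1 z -> urysohn_limit (upper s) z = 1.
    by move=> z1; apply: (urysohn_limit1 nu); exact: (split_sub ns).
  rewrite !(urysohn_limit_split _ ns) exprS (u1 y y1) (u1 x x1).
  by move: ly; rewrite /lower !ler_norml; lra.
have [x2|x2] := pselect ((split s).2 x); last first.
  have : nbhs x (~` (split s).2).
    by apply: open_nbhs_nbhs; split=> //; apply: closed_openC; case: nu.
  apply: filterS2 (IH _ nu) => y uy y2.
  have l0 z : ~ (split s).2 z -> urysohn_limit (lower s) z = 0.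
    by move=> z2; apply: (urysohn_limit0 nl) => /(split_sub ns).
  rewrite !(urysohn_limit_split _ ns) exprS (l0 y y2) (l0 x x2).
  by move: uy; rewrite /upper !ler_norml; lra.
apply: filterS2 (urysohn_limit_near0 n nl x1) (urysohn_limit_near1 n nu x2) =>
  y ly uy.
have l0 : urysohn_limit (lower s) x = 0 by exact: (urysohn_limit0 nl).
have u1 : urysohn_limit (upper s) x = 1 by exact: (urysohn_limit1 nu).
rewrite !(urysohn_limit_split _ ns) exprS l0 u1 ler_norml.
have := urysohn_limit_itv y nl; have := urysohn_limit_itv y nu.
by move: ly uy; rewrite /upper /lower; lra.
Qed.

Lemma urysohn_limit_continuous s : nested s -> continuous (urysohn_limit s).
Proof.
move=> ns; apply: nbhs_norm_continuous => x e e0.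
have [n ne] : exists n, (2^-1 : R) ^+ n <= e.
  have : (2^-1 : R) ^+ n @[n --> \oo] --> 0.
    by apply: cvg_expr; rewrite ger0_norm ?invr_ge0 // invf_lt1 ?ltr1n.
  move=> /cvgrPdist_le /(_ e e0) [n _ /(_ n (leqnn n))] /=.
  rewrite sub0r normrN ger0_norm ?exprn_ge0 ?invr_ge0//; by exists n.
by apply: filterS (urysohn_limit_osc n x ns) => y /le_trans; apply.
Qed.

End MonotoneUrysohn.

(** Order normality provides the splitting: [s.1] and the complement of [s.2] are separated by an
    open upset [U] and an open downset [V], and [U] is contained in the closed upset complementary
    to [V]. *)
Lemma monotone_urysohn {R : realType} {X : topologicalType} (le : set (X * X))
    (K : nat -> set X) (lcX : locally_compact [set: X])
    (hsX : hausdorff_space X) (eK : exhaustion K) (le_closed : closed le)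
    (le_refl : forall x, le (x, x))
    (le_trans : forall x y z, le (x, y) -> le (y, z) -> le (x, z))
    (C D : set X) :
  closed C -> closed D -> upset le C -> downset le D -> C `&` D = set0 ->
  exists L : X -> R, [/\ continuous L, forall x, 0 <= L x <= 1,
    forall x y, le (x, y) -> L x <= L y,
    forall x, C x -> L x = 1 & forall x, D x -> L x = 0].
Proof.
move=> clC clD uC dD CD0.
have dC (A : set X) : downset le A -> upset le (~` A).
  by move=> dA x y nAx xy Ay; apply: nAx; exact: dA xy.
have uD (A : set X) : upset le A -> downset le (~` A).
  by move=> uA x y nAy xy Ax; apply: nAy; exact: uA xy.
have /choice[split splitP] : forall s : set X * set X, exists m, nested le s ->
    [/\ nested le (s.1, m.1), nested le (m.2, s.2) & m.1 `<=` m.2].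
  move=> s; have [[clA uA oB uB AB]|ns] := pselect (nested le s);
    last by exists s.
  have [|[U V] /= [oU uU oV dV] [AU BV UV]] :=
      preorder_normal lcX hsX le_closed le_refl le_trans eK clA (open_closedC
        oB) uA (uD _ uB).
    by apply/seteqP; split => // x [/AB].
  exists (U, ~` V) => _; split => /=.
  - by split.
  - split => //=; [exact: open_closedC|exact: dC|].
    by move=> x nVx; apply: contrapT => /BV.
  - move=> x Ux Vx; suff : (U `&` V) x by rewrite UV.
    by split.
have nCD : nested le (C, ~` D).
  split => //=; [exact: closed_openC|exact: dC|].
  by move=> x Cx Dx; suff : (C `&` D) x by rewrite CD0.
have sP s : nested le s ->
  nested le (s.1, (split s).1) /\ nested le ((split s).2, s.2).
  by move=> /splitP[].
have sS s : nested le s -> (split s).1 `<=` (split s).2 by move=> /splitP[].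
exists (urysohn_limit split (C, ~` D)); split.
- exact: (urysohn_limit_continuous sP sS).
- by move=> x; exact: (urysohn_limit_itv sP sS).
- by move=> x y; exact: (urysohn_limit_mono sP sS).
- by move=> x Cx; rewrite (urysohn_limit1 sP sS).
- by move=> x Dx; rewrite (urysohn_limit0 sP sS)//=; exact.
Qed.

(** * Averaging along orbits *)

Lemma bounded_continuousP {R : realType} {X : topologicalType} (u : X -> R) :
  bounded_continuous u <-> continuous u /\ exists M, forall x, `|u x| <= M.
Proof.
split=> -[cu bu]; split => //.
  have [M [_ Mu]] := bu; exists (M + 1) => x.
  by apply: (Mu (M + 1)); rewrite ?ltrDl.
by have [M Mu] := bu; exists M; split; [exact: num_real|move=> N /ltW MN x _;
  exact: le_trans MN].
Qed.

(** Vanishing at infinity, without continuity. *)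
Definition vanishing {R : realType} {X : topologicalType} (u : X -> R) :=
  forall e, 0 < e -> exists2 K, compact K & forall x, ~ K x -> `|u x| <= e.

Section Averaging.
Context {R : realType} {X : topologicalType} (f : X -> X) (K : nat -> set X).
Hypothesis cf : continuous f.
Hypothesis eK : exhaustion K.
Hypothesis fK : forall n, f @` K n `<=` K n.+1.

Section Average.
Context (L eps : X -> R).
Hypothesis cL : continuous L.
Hypothesis L01 : forall x, 0 <= L x <= 1.
Hypothesis Lf : forall x, L x <= L (f x).
Hypothesis ceps : continuous eps.
Hypothesis eps01 : forall x, 0 <= eps x <= 1.
Hypothesis epsK : forall n x, K n x -> n.+1%:R^-1 <= eps x.

(* Expected value of [L] where the orbit of [x] is stopped at each point [z]
   with probability [eps z], and at the latest after [k] steps. *)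
Fixpoint stopped_average k x := if k is j.+1
  then eps x * L x + (1 - eps x) * stopped_average j (f x) else L x.

Lemma stopped_average_continuous k : continuous (stopped_average k).
Proof.
elim: k => [//|k IH] x /=; apply: cvgD; first by apply: cvgM;
  [exact: ceps|exact: cL].
apply: cvgM; first by apply: cvgB; [exact: cvg_cst|exact: ceps].
by apply: continuous_comp; [exact: cf|exact: IH].
Qed.

Lemma stopped_average_le1 k x : stopped_average k x <= 1.
Proof.
elim: k x => [|k IH] x /=; first by have /andP[] := L01 x.
have := IH (f x); have := L01 x; have := eps01 x; nra.
Qed.

Lemma stopped_average_ge k x : L x <= stopped_average k x.
Proof.
elim: k x => [//|k IH] x /=.
have := IH (f x); have := Lf x; have := eps01 x; nra.
Qed.

Lemma stopped_average_ndecr x : nondecreasing_seq (stopped_average^~ x).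
Proof.
apply/nondecreasing_seqP => k; elim: k x => [|k IH] x.
  exact: stopped_average_ge.
have := IH (f x); have := eps01 x; rewrite /= ; nra.
Qed.

(** The difference is at most the probability of surviving [k] steps. After [i] steps the orbit is
    in [K (n + 1 + i)], so survival has probability at most the product of
    [(n + 1 + i) / (n + 2 + i)] over [i < k], which telescopes to the bound. *)
Lemma stopped_average_cauchy n k j x : K n.+1 x ->
  stopped_average (k + j) x - stopped_average k x <= n.+1%:R / (n.+1 + k)%:R.
Proof.
elim: k n x => [|k IH] n x Kx.
  rewrite addn0 divff ?pnatr_eq0// add0n.
  have := stopped_average_le1 j x; have := L01 x; rewrite /=; lra.
have Kfx : K n.+2 (f x) by apply: fK; exists x.
have := IH _ _ Kfx; have := epsK Kx; rewrite addSn /=.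
have -> : n.+1%:R / (n.+1 + k.+1)%:R = (1 - n.+2%:R^-1) * (n.+2%:R / (n.+2 +
  k)%:R) :> R.
  rewrite addnS !addSn -!natr1; field.
  by rewrite -!natrD !natr1 !pnatr_eq0.
set a := stopped_average _ _; set b := stopped_average _ _.
have ba : b <= a by apply: stopped_average_ndecr; exact: leq_addr.
set d := n.+2%:R^-1; set r := _ / _ => de abr.
have d1 : d <= 1 by rewrite invf_le1// ler1n.
have := eps01 x; have r0 : 0 <= r by rewrite divr_ge0.
have -> : eps x * L x + (1 - eps x) * a - (eps x * L x + (1 - eps x) * b) = (1
  - eps x) * (a - b) by ring.
move=> e01; apply: ler_pM => //; lra.
Qed.

Definition average x := lim (stopped_average k x @[k --> \oo]).

Lemma stopped_average_is_cvg x : cvg (stopped_average k x @[k --> \oo]).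
Proof.
apply: nondecreasing_is_cvgn; first exact: stopped_average_ndecr.
by exists 1 => _ [n _ <-]; exact: stopped_average_le1.
Qed.

Lemma average_step x : average x = eps x * L x + (1 - eps x) * average (f x).
Proof.
apply: cvg_lim => //; rewrite -cvg_shiftS /=.
apply: cvgD; first exact: cvg_cst.
by apply: cvgM; [exact: cvg_cst|exact: stopped_average_is_cvg].
Qed.

Lemma average_ge x : L x <= average x.
Proof.
apply: limr_ge; first exact: stopped_average_is_cvg.
by apply: nearW => k; exact: stopped_average_ge.
Qed.

Lemma average_le1 x : average x <= 1.
Proof.
apply: limr_le; first exact: stopped_average_is_cvg.
by apply: nearW => k; exact: stopped_average_le1.
Qed.

(** By [average_step] the increment is [eps x] times [average (f x) - L x], and this factor lies in
    [0, 1]. *)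
Lemma average_increment x : 0 <= average (f x) - average x <= eps x.
Proof.
rewrite (average_step x); have := average_le1 (f x); have := average_ge (f x).
have := Lf x; have := L01 x; have := eps01 x.
set a := average _; set b := L (f x); nra.
Qed.

(** The Cauchy bound is uniform on [K n.+1], a neighbourhood of every point of [K n]; so the average
    is a locally uniform limit of continuous functions. *)
Lemma average_continuous : continuous average.
Proof.
have [_ sK KT] := eK.
apply: nbhs_norm_continuous => x e e0.
have [n _ Kx] : (\bigcup_n K n) x by rewrite KT.
have [k kP] : exists k, n.+1%:R / (n.+1 + k)%:R <= e / 3.
  have e3 : 0 < e / 3 by rewrite divr_gt0.
  (* Any [k] beyond [(n + 1) / (e / 3)] makes the tail small enough. *)
  exists (Num.truncn (n.+1%:R / (e / 3))).+1.
  rewrite ler_pdivrMr ?ltr0n// mulrC -ler_pdivrMr//.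
  rewrite natrD (le_trans (ltW (truncnS_gt _)))// lerDr ler0n//.
have close y : K n.+1 y -> `|average y - stopped_average k y| <= e / 3.
  move=> Ky; apply: le_trans kP; rewrite ger0_norm ?subr_ge0; last first.
    by apply: nondecreasing_cvgn_le;
      [exact: stopped_average_ndecr|exact: stopped_average_is_cvg].
  rewrite lerBlDr; apply: limr_le; first exact: stopped_average_is_cvg.
  exists k => // j /= /subnKC <-; rewrite -lerBlDr.
  exact: stopped_average_cauchy.
have e3 : 0 < e / 3 by rewrite divr_gt0.
have /cvgrPdist_le /(_ _ e3) := @stopped_average_continuous k x.
apply: filterS2 (sK _ _ Kx) => y Ky; have := close _ Ky.
have := close _ (interior_subset (sK _ _ Kx)).
rewrite !ler_norml; lra.
Qed.

End Average.

Context (phi : nat -> X -> R).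
Hypothesis phi_cts : forall n, continuous (phi n).
Hypothesis phi01 : forall n x, 0 <= phi n x <= 1.
Hypothesis phi1 : forall n x, K n x -> phi n x = 1.
Hypothesis phi0 : forall n x, ~ K n.+1 x -> phi n x = 0.

(** [tau] is the sum of all [1 - phi k]. On [K n] only the terms with [k < n] can be nonzero, and
    off [K n] these are all equal to 1. *)
Lemma proper_function : exists tau : X -> R, [/\ continuous tau,
  forall n x, K n x -> tau x <= n%:R & forall n x, ~ K n x -> n%:R <= tau x].
Proof.
have [_ sK KT] := eK.
have /choice[N NP] : forall x, exists n, K n x.
  move=> x; have [n _ Kx] : (\bigcup_n K n) x by rewrite KT.
  by exists n.
pose s n x := \sum_(k < n) (1 - phi k x).
(* Partial sums are stationary from any index whose compact set contains [x], so cutting the sum at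
   the chosen index [N x] is harmless. *)
have sE m n x : (m <= n)%N -> K m x -> s n x = s m x.
  move=> /subnKC <- Kx; elim: (n - m)%N => [|k IH]; first by rewrite addn0.
  rewrite addnS /s big_ord_recr/= -/(s _ x) IH phi1 ?subrr ?addr0//.
  by apply: exhaustion_mono Kx => //; exact: leq_addr.
have sN n x : K n x -> s (N x) x = s n x.
  move=> Kx; rewrite -(@sE n (maxn n (N x)))// ?leq_maxl//.
  by rewrite -(@sE (N x) (maxn n (N x)))// leq_maxr.
have s_le n x : s n x <= n%:R.
  have -> : n%:R = \sum_(k < n) (1 : R) by rewrite sumr_const card_ord.
  by apply: ler_sum => k _; have := phi01 k x; lra.
exists (fun x => s (N x) x); split.
- apply: nbhs_norm_continuous => x e e0; set n := (N x).+1.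
  have Kx : K n x by apply: interior_subset; exact/sK/NP.
  have /cvgrPdist_le /(_ _ e0) : s n y @[y --> x] --> s n x.
    apply: (cvg_big (op := +%R)) => [|k _]; first exact: add_continuous.
    by apply: cvgB; [exact: cvg_cst|exact: phi_cts].
  apply: filterS2 (sK _ _ (NP x)) => y Ky.
  by rewrite distrC (sN _ _ Ky) (sN _ _ Kx).
- by move=> n x /sN ->.
- move=> n x nKx; have nN : (n <= N x)%N.
    rewrite leqNgt; apply/negP => /ltnW Nn; apply: nKx.
    exact: exhaustion_mono (NP x).
  have -> : n%:R = s n x.
    rewrite /s (eq_bigr (fun=> 1)) ?sumr_const ?card_ord// => k _.
    rewrite phi0 ?subr0// => Kx; apply: nKx.
    by apply: exhaustion_mono Kx => //; exact: ltn_ord.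
  rewrite -(subnKC nN); elim: (N x - n)%N => [|k IH]; first by rewrite addn0.
  rewrite addnS /s big_ord_recr/= -/(s _ x) (le_trans IH)// lerDl subr_ge0.
  by have /andP[] := phi01 (n + k)%N x.
Qed.

End Averaging.

(** * The closed preorder generated by a map *)

Lemma closed_diagonal {X : topologicalType} (hsX : hausdorff_space X) :
  closed (diagonal : set (X * X)).
Proof.
rewrite -openC openE => -[x y] /= xy.
have := hsX; rewrite open_hausdorff => /(_ x y) [|[U V] /= [Ux Vy] [oU oV UV]].
  by apply/eqP => /(xy).
exists (U, V) => /=.
  by split; apply: open_nbhs_nbhs; split => //; exact: set_mem.
move=> [a b] /= [Ua Vb] ab; have : (U `&` V) a by split => //;
  rewrite /diagonal/= in ab; rewrite ab.
by rewrite (eqP UV).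
Qed.

Section Hull.
Context {X : topologicalType} (f : X -> X).

Lemma closed_transitive_hull_closed : closed (closed_transitive_hull f).
Proof. by apply: closed_bigI => E [[clE _] _]. Qed.

Lemma closed_transitive_hull_trans x y z : closed_transitive_hull f (x, y) ->
  closed_transitive_hull f (y, z) -> closed_transitive_hull f (x, z).
Proof.
by move=> xy yz E [[clE tE] fE]; apply: (tE x y z); [exact: xy|exact: yz].
Qed.

Lemma closed_transitive_hull_graph x : closed_transitive_hull f (x, f x).
Proof. by move=> E [_ fE]; exact: fE. Qed.

Definition recurrence_order : set (X * X) :=
  diagonal `|` closed_transitive_hull f.

Lemma recurrence_order_trans x y z : recurrence_order (x, y) ->
  recurrence_order (y, z) -> recurrence_order (x, z).
Proof.
move=> [/= xy|xy] [/= yz|yz].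
- by left; rewrite /diagonal /= in xy yz *; rewrite xy.
- by right; rewrite /diagonal /= in xy; rewrite xy.
- by right; rewrite /diagonal /= in yz; rewrite -yz.
- by right; exact: closed_transitive_hull_trans yz.
Qed.

(** The relation [L x <= L y] is closed, transitive and contains the graph of [f], hence contains
    its hull. *)
Lemma lyapunov_recurrence_order {R : realType} (L : X -> R) x y :
  lyapunov f L -> recurrence_order (x, y) -> L x <= L y.
Proof.
move=> [[cL _] Lf] [|]; first by rewrite /diagonal /= => ->.
move=> /(_ [set xy | L xy.1 <= L xy.2]); apply; split; last first.
  by move=> [a b]; rewrite /graph /= => <-.
split; last by move=> a b c /=; exact: le_trans.
rewrite -openC openE => -[a b] /= /negP; rewrite -ltNge => ba.
exists ([set z | (L a + L b) / 2 < L z], [set z | L z < (L a + L b) / 2]) => /=.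
  split; first by apply: (cvgr_gt (L a) (cL a)); lra.
  by apply: (cvgr_lt (L b) (cL b)); lra.
by move=> [c d] /= [cm dm]; apply/negP; rewrite -ltNge; exact: lt_trans cm.
Qed.
End Hull.

(** The case of the equality order, for which every set is both an upset and a downset. *)
Lemma exhaustion_urysohn {R : realType} {X : topologicalType}
    (K : nat -> set X) (C D : set X) :
  locally_compact [set: X] -> hausdorff_space X -> exhaustion K ->
  closed C -> closed D -> C `&` D = set0 ->
  exists u : X -> R, [/\ continuous u, forall x, 0 <= u x <= 1,
    forall x, C x -> u x = 1 & forall x, D x -> u x = 0].
Proof.
move=> lcX hsX eK clC clD CD0.
have [| | | |u [cu u01 _ u1 u0]] := @monotone_urysohn R X diagonal K lcX hsX eK
  (closed_diagonal hsX) _ _ C D clC clD _ _ CD0.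
- by [].
- by move=> a b c /diagonalP -> /diagonalP ->.
- by move=> a b Ca /diagonalP <-.
- by move=> a b Db /diagonalP ->.
by exists u.
Qed.

(** * Separating Lyapunov functions with increment vanishing at infinity *)

Section Separation.
Context {R : realType} {X : topologicalType} (f : X -> X).
Hypothesis lcX : locally_compact [set: X].
Hypothesis scX : sigma_compact X.
Hypothesis hsX : hausdorff_space X.
Hypothesis cf : continuous f.

Lemma exhaustion_bump (K : nat -> set X) : exhaustion K ->
  exists phi : nat -> X -> R, [/\ forall n, continuous (phi n),
    forall n x, 0 <= phi n x <= 1, forall n x, K n x -> phi n x = 1 &
    forall n x, ~ K n.+1 x -> phi n x = 0].
Proof.
move=> eK; have [cK sK KT] := eK.
have /choice[phi phiP] : forall n, exists u : X -> R,
    [/\ continuous u, forall x, 0 <= u x <= 1,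
        forall x, K n x -> u x = 1 & forall x, ~ (K n.+1)° x -> u x = 0].
  move=> n; apply: exhaustion_urysohn => //.
  - exact: compact_closed.
  - by apply: open_closedC; exact: open_interior.
  - by apply/seteqP; split => // x [/sK].
exists phi; split=> n; have [c b p1 p0] := phiP n => //.
by move=> x Kx; apply: p0 => /interior_subset.
Qed.

Lemma vanishing_lyapunov_separates x y : ~ recurrence_order f (x, y) ->
  exists L : X -> R,
    [/\ lyapunov f L, vanishing (fun z => L (f z) - L z) & L y < L x].
Proof.
move=> nxy; have [K eK fK] := exhaustion_exists lcX hsX scX cf.
have [cK sK KT] := eK.
have [L [cL L01 Lmono L1 L0]] : exists L : X -> R, [/\ continuous L,
    forall x, 0 <= L x <= 1,
    forall x y, recurrence_order f (x, y) -> L x <= L y, L x = 1 & L y = 0].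
  have le_refl z : recurrence_order f (z, z) by left.
  have cle : closed (recurrence_order f).
    by apply: closedU; [exact: closed_diagonal|exact:
      closed_transitive_hull_closed].
  have le_tr := @recurrence_order_trans _ f.
  (* The points above [x] and the points below [y] form disjoint closed sets exactly because [x] is
     not below [y]. *)
  have [| | | | |L [cL L01 Lm L1 L0]] :=
    @monotone_urysohn R X _ K lcX hsX eK cle
      le_refl le_tr (upclosure (recurrence_order f) [set x])
      (downclosure (recurrence_order f) [set y]).
  - by apply: upclosure_closed => //; exact: compact_set1.
  - by apply: downclosure_closed => //; exact: compact_set1.
  - by move=> a b [c cx ca] ab; exists c => //; exact: le_tr ab.
  - by move=> a b [c cx ca] ab; exists c => //; exact: le_tr ca.
  - apply/seteqP; split => // a [[_ -> xa] [_ -> ay]]; apply: nxy.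
    exact: le_tr ay.
  exists L; split => //; first by apply: L1; exists x.
  by apply: L0; exists y.
have [phi [phic phi01 phi1 phi0]] := exhaustion_bump eK.
have [tau [ctau tau_le tau_ge]] := proper_function eK phic phi01 phi1 phi0.
have [m _ Ky] : (\bigcup_n K n) y by rewrite KT.
(* On [K m], hence at [y], [tau] is at most [m] and [eps] is 1; on [K n] the maximum is at most
   [n + 1]; and [eps] vanishes at infinity because [tau] grows. *)
pose eps z := (Num.max 1 (tau z - m%:R))^-1.
have max_gt0 z : 0 < Num.max 1 (tau z - m%:R) by rewrite lt_max ltr01.
have ceps : continuous eps.
  move=> z; apply: cvgV; first exact: lt0r_neq0.
  apply: (@continuous_max _ _ (cst 1) (fun z => tau z - m%:R));
    first exact: cvg_cst.
  by apply: cvgB; [exact: ctau|exact: cvg_cst].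
have eps01 z : 0 <= eps z <= 1.
  rewrite /eps invr_ge0 (ltW (max_gt0 z)) invf_le1// le_max lexx//.
have epsK n z : K n z -> n.+1%:R^-1 <= eps z.
  move=> /tau_le tn; rewrite /eps lef_pV2 ?posrE// ge_max ler1n/=.
  rewrite lerBlDr (le_trans tn)// -natrD ler_nat.
  by rewrite leqW// leq_addr.
have Lf z : L z <= L (f z) by apply: Lmono; right;
  exact: closed_transitive_hull_graph.
have L'f z := average_increment L01 Lf eps01 z.
exists (average f L eps); split.
- split; last by move=> z; have /andP[] := L'f z; rewrite subr_ge0.
  apply/bounded_continuousP; split.
    exact: (average_continuous cf eK fK cL L01 Lf ceps eps01 epsK).
  exists 1 => z; have := average_le1 L01 Lf eps01 z.
  by have := average_ge L01 Lf eps01 z; have := L01 z; rewrite ler_norml; lra.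
- move=> e e0.
  (* Off this set [tau z - m] exceeds [1 / e], so the increment, bounded by [eps z], is below
     [e]. *)
  exists (K (m + (Num.truncn e^-1).+1)%N) => // z nKz.
  have /andP[le0 /le_trans] := L'f z; rewrite ger0_norm//; apply.
  rewrite /eps -[leRHS]invrK lef_pV2 ?posrE ?invr_gt0// le_max.
  apply/orP; right; rewrite lerBrDl (le_trans _ (tau_ge _ _ nKz))//.
  by rewrite natrD lerD2l ltW// truncnS_gt.
(* The orbit of [y] is stopped at once, so the average at [y] is still [L y], which is 0. *)
- have ey : eps y = 1.
    by rewrite /eps max_l ?invr1// lerBlDr (le_trans (tau_le _ _ Ky))// lerDr.
  rewrite (average_step L01 Lf eps01 y) ey subrr mul0r addr0 mul1r L0.
  by rewrite (lt_le_trans _ (average_ge L01 Lf eps01 x))// L1.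
Qed.
End Separation.

(** * The Stone-Weierstrass theorem *)

Definition uniformly_approximable {R : realType} {T : Type} (A : set (T -> R))
    (u : T -> R) :=
  forall e, 0 < e -> exists2 w, A w & forall x, `|u x - w x| <= e.

(** A closed subalgebra over a bare type and without boundedness, so that the same lemmas serve on
    [X] and on its compactification. *)
Definition uniform_algebra {R : realType} {T : Type} (A : set (T -> R)) :=
  [/\ A (cst 1),
      forall (a : R) u v, A u -> A v -> A (fun x => a * u x + v x),
      forall u v, A u -> A v -> A (fun x => u x * v x) &
      uniformly_approximable A `<=` A].

Lemma closed_uniformP {R : realType} {T : choiceType} (A : set (T -> R)) :
  closed (A : set {uniform T -> R}) <-> uniformly_approximable A `<=` A.
Proof.
split=> [clA u uA|uA u clu].
  apply: clA => B /uniform_nbhs[E [entE EB]].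
  have [e e0 eE] : exists2 e, 0 < e & forall a b : R, `|a - b| <= e -> E (a, b).
    move: entE; rewrite -entourage_ballE => -[e /= e0 eE].
    (* Halving passes from the non-strict bound to the strict inequality that defines the ball. *)
    exists (e / 2); first by rewrite divr_gt0.
    move=> a b ab; apply: eE; rewrite /ball /=; lra.
  have [w Aw uw] := uA _ e0; exists w; split => //.
  by apply: EB => x _; exact: eE.
apply: uA => e e0.
have [|w [Aw uw]] := clu [set w | forall x, `|u x - w x| <= e].
  apply/uniform_nbhs; exists [set ab | `|ab.1 - ab.2| <= e]; split.
    rewrite -entourage_ballE; exists e => //= -[a b]; rewrite /ball /= => /ltW.
    by [].
  by move=> w uw x; exact: uw.
by exists w.
Qed.

Lemma closed_subalgebraP {R : realType} {X : topologicalType} (A : set (X ->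
  R)) :
  closed_subalgebra A <-> A `<=` @bounded_continuous R X /\ uniform_algebra A.
Proof.
split=> [[bA A1 Al AM /closed_uniformP clA]|[bA [A1 Al AM clA]]].
  by split.
by split => //; exact/closed_uniformP.
Qed.

Section UniformAlgebra.
Context {R : realType} {T : Type} (A : set (T -> R)).
Hypothesis uA : uniform_algebra A.

Lemma uniform_algebra_cst c : A (fun=> c).
Proof.
have [A1 Al _ _] := uA.
have := Al (c - 1) _ _ A1 A1; congr A.
by apply/funext => x /=; rewrite mulr1 subrK.
Qed.

Lemma uniform_algebraZ c u : A u -> A (fun x => c * u x).
Proof.
move=> Au; have [_ Al _ _] := uA.
have := Al c _ _ Au (uniform_algebra_cst 0); congr A.
by apply/funext => x /=; rewrite addr0.
Qed.

Lemma uniform_algebraD u v : A u -> A v -> A (fun x => u x + v x).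
Proof.
move=> Au Av; have [_ Al _ _] := uA.
have := Al 1 _ _ Au Av; congr A.
by apply/funext => x /=; rewrite mul1r.
Qed.

Lemma uniform_algebraB u v : A u -> A v -> A (fun x => u x - v x).
Proof.
move=> Au Av; have [_ Al _ _] := uA.
have := Al (-1) _ _ Av Au; congr A.
by apply/funext => x /=; rewrite mulN1r addrC.
Qed.

Lemma uniform_algebraM u v : A u -> A v -> A (fun x => u x * v x).
Proof. by move=> Au Av; have [_ _ AM _] := uA; exact: AM. Qed.

(* Polynomials in [t] converging to [`|t|] uniformly on [-1, 1]. *)
Fixpoint abs_approx k (t : R) := if k is j.+1
  then abs_approx j t + (t ^+ 2 - abs_approx j t ^+ 2) / 2 else 0.

(** For [s] the absolute value and [p] the approximation, the error [d = s - p] becomes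
    [d (1 - (s + p) / 2)], at most [d (1 - d / 2)] since [p] is nonnegative. The map [x (1 - x / 2)]
    increases on [0, 1] and sends [2 / n] below [2 / (n + 1)]. *)
Lemma abs_approxP k t : `|t| <= 1 ->
  abs_approx k t <= `|t| <= abs_approx k t + 2 / k.+2%:R.
Proof.
set s := `|t| => s1; have s0 : 0 <= s by exact: normr_ge0.
have ts : t ^+ 2 = s ^+ 2 by rewrite /s -normrX ger0_norm ?sqr_ge0.
suff : 0 <= abs_approx k t <= s /\ s - abs_approx k t <= 2 / k.+2%:R.
  by move=> [/andP[_ ->]]; rewrite lerBlDl.
elim: k => [|k [IH1 IH2]] /=.
  by rewrite lexx s0 subr0 divff ?pnatr_eq0.
rewrite ts; move: IH1 IH2; set p := abs_approx k t => IH1 IH2.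
have sp : 0 <= (s - p) * (2 - s - p) by apply: mulr_ge0; lra.
have sp' : 0 <= (s - p) * (s + p) by apply: mulr_ge0; lra.
split; first by apply/andP; split; nra.
set b : R := 2 / k.+2%:R in IH2.
have b0 : 0 <= b by rewrite /b divr_ge0.
have b1 : b <= 1 by rewrite /b ler_pdivrMr ?ltr0n// mul1r ler_nat.
have bb : b * (1 - b / 2) <= 2 / k.+3%:R.
  rewrite /b -[k.+3%:R]natr1; have : 0 < (k.+2%:R : R) by rewrite ltr0n.
  set n : R := k.+2%:R => n0.
  have -> : 2 / n * (1 - 2 / n / 2) = 2 * (n - 1) / n ^+ 2 by field;
    rewrite gt_eqF.
  rewrite ler_pdivrMr ?exprn_gt0// mulrAC ler_pdivlMr; nra.
apply: le_trans bb.
have : 0 <= (b - (s - p)) * (2 - (s - p) - b) by apply: mulr_ge0; lra.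
have : 0 <= (s - p) * p by apply: mulr_ge0; lra.
nra.
Qed.

Lemma uniform_algebra_abs u M : A u -> (forall x, `|u x| <= M) ->
  A (fun x => `|u x|).
Proof.
move=> Au uM; have [_ _ _ clA] := uA.
(* The maximum with 1 keeps the scaling factor positive whatever [M] is. *)
pose N := Num.max 1 M.
have N0 : 0 < N by rewrite lt_max ltr01.
have uN x : `|u x / N| <= 1.
  by rewrite normrM normfV (gtr0_norm N0) ler_pdivrMr// mul1r le_max uM orbT.
have Ak k : A (fun x => abs_approx k (u x / N)).
  elim: k => [|k IH] /=; first exact: uniform_algebra_cst.
  apply: (uniform_algebraD IH).
  have AN : A (fun x => u x / N).
    by have := uniform_algebraZ N^-1 Au; congr A; apply/funext => x;
      rewrite mulrC.
  have := uniform_algebraZ 2^-1 (uniform_algebraB (uniform_algebraM AN AN)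
    (uniform_algebraM IH IH)).
  by congr A; apply/funext => x /=; rewrite mulrC !expr2.
apply: clA => e e0.
have [k kP] : exists k, N * (2 / k.+2%:R) <= e.
  exists (Num.truncn (e^-1 * (N * 2))).
  rewrite mulrA ler_pdivrMr ?ltr0n// -ler_pdivrMl//.
  by apply: le_trans (ltW (truncnS_gt _)) _; rewrite ler_nat.
exists (fun x => N * abs_approx k (u x / N)); first exact: uniform_algebraZ.
move=> x; have /andP[p1 p2] := abs_approxP k (uN x).
have -> : `|u x| = N * `|u x / N|.
  by rewrite normrM normfV (gtr0_norm N0) mulrC divfK// gt_eqF.
rewrite -mulrBr normrM (gtr0_norm N0) (le_trans _ kP)// ler_pM2l//.
by rewrite ger0_norm ?subr_ge0// lerBlDl.
Qed.

End UniformAlgebra.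

Lemma compact_continuous_bounded {R : realType} {T : topologicalType}
    (K : set T) (u : T -> R) : compact K -> continuous u ->
  exists M, forall x, K x -> `|u x| <= M.
Proof.
move=> cK cu.
apply: (compact_union_ind (P := fun S =>
  exists M, forall x, S x -> `|u x| <= M)) => //.
- by exists 0.
- move=> S S' [M uM] [M' uM']; exists (Num.max M M') => x [/uM|/uM'].
    by move=> /le_trans -> //; rewrite le_max lexx.
  by move=> /le_trans -> //; rewrite le_max lexx orbT.
- by move=> S S' SS [M uM]; exists M => x /SS /uM.
- move=> x _; exists [set y | `|u x - u y| <= 1].
    by have /cvgrPdist_le/(_ 1 ltr01) := cu x.
  exists (`|u x| + 1) => y /= xy; have -> : u y = u x - (u x - u y) by lra.
  by rewrite (le_trans (ler_normB _ _))// lerD2l.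
Qed.

Section StoneWeierstrass.
Context {R : realType} {T : topologicalType} (A : set (T -> R)).
Hypothesis cT : compact [set: T].
Hypothesis uA : uniform_algebra A.
Hypothesis cA : forall u, A u -> continuous u.
Hypothesis sepA : forall x y, x <> y -> exists2 u, A u & u x <> u y.

Lemma uniform_algebra_max u v : A u -> A v -> A (fun x => Num.max (u x) (v x)).
Proof.
move=> Au Av; have Auv := uniform_algebraB uA Au Av.
have [M uMT] := compact_continuous_bounded cT (cA Auv).
have uM x : `|u x - v x| <= M by exact: uMT.
have := uniform_algebraZ uA 2^-1 (uniform_algebraD uA (uniform_algebraD uA Au
  Av) (uniform_algebra_abs uA Auv uM)).
by congr A; apply/funext => x /=; rewrite maxr_absE mulrC.
Qed.

Lemma uniform_algebra_min u v : A u -> A v -> A (fun x => Num.min (u x) (v x)).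
Proof.
move=> Au Av; have Auv := uniform_algebraB uA Au Av.
have [M uMT] := compact_continuous_bounded cT (cA Auv).
have uM x : `|u x - v x| <= M by exact: uMT.
have := uniform_algebraZ uA 2^-1 (uniform_algebraB uA (uniform_algebraD uA Au
  Av) (uniform_algebra_abs uA Auv uM)).
by congr A; apply/funext => x /=; rewrite minr_absE mulrC.
Qed.

Lemma uniform_algebra_interpolate p q (v : T -> R) :
  exists u, [/\ A u, u p = v p & u q = v q].
Proof.
have [->|pq] := pselect (p = q).
  by exists (fun=> v q); split => //; exact: uniform_algebra_cst.
have [w Aw wpq] := sepA pq.
have wpq0 : w q - w p != 0 by rewrite subr_eq0; apply/eqP => /esym.
exists (fun x => ((v q - v p) / (w q - w p)) * (w x - w p) + v p); split.
- apply: (uniform_algebraD uA _ (uniform_algebra_cst uA _)).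
  apply: (uniform_algebraZ uA).
  exact: (uniform_algebraB uA Aw (uniform_algebra_cst uA _)).
- by rewrite subrr mulr0 add0r.
- by rewrite divfK// subrK.
Qed.

(** The lattice proof. Two-point interpolants through [p] are combined by finite minima into a
    function below [v + e] that still equals [v] at [p]; finite maxima of these are then also above
    [v - e]. *)
Lemma stone_weierstrass (v : T -> R) : continuous v -> A v.
Proof.
move=> cv; have [_ _ _ clA] := uA; apply: clA => e e0.
have e2 : 0 < e / 2 by rewrite divr_gt0.
have near_le u x : A u -> u x = v x -> nbhs x [set z | `|u z - v z| <= e].
  move=> Au uvx.
  have /cvgrPdist_le/(_ _ e2) ux := cA Au (x := x).
  have /cvgrPdist_le/(_ _ e2) vx := cv x.
  apply: filterS2 ux vx => z /=; rewrite uvx !ler_norml; lra.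
have above p : exists u, [/\ A u, u p = v p & forall z, u z <= v z + e].
  suff [u [Au up uv]] : exists u, [/\ A u, u p = v p &
      forall z, [set: T] z -> u z <= v z + e].
    by exists u; split => // z; exact: uv.
  apply: (compact_union_ind (P := fun S => exists u, [/\ A u, u p = v p &
      forall z, S z -> u z <= v z + e])) => //.
  - by exists (fun=> v p); split => //; exact: uniform_algebra_cst.
  - move=> S S' [u [Au up uS]] [u' [Au' up' uS']].
    exists (fun x => Num.min (u x) (u' x)); split.
    + exact: uniform_algebra_min.
    + by rewrite up up' minxx.
    + by move=> z [/uS|/uS'] uz; rewrite ge_min uz ?orbT.
  - by move=> S S' SS [u [Au up uS]]; exists u; split => // z /SS /uS.
  - move=> q _; have [u [Au up uq]] := uniform_algebra_interpolate p q v.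
    exists [set z | `|u z - v z| <= e]; first exact: near_le.
    by exists u; split => // z /=; rewrite ler_norml; lra.
(* A point is needed because the base case of the second induction takes its function from
   [above]. *)
have [[p _]|T0] := pselect ([set: T] !=set0); last first.
  exists (cst 1); first by have [] := uA.
  by move=> x; exfalso; apply: T0; exists x.
suff [u [Au uv vu]] : exists u, [/\ A u, forall z, u z <= v z + e &
    forall z, [set: T] z -> v z - e <= u z].
  by exists u => // z; have := uv z; have := vu z I; rewrite ler_norml; lra.
apply: (compact_union_ind (P := fun S => exists u, [/\ A u,
    forall z, u z <= v z + e & forall z, S z -> v z - e <= u z])) => //.
- by have [u [Au _ uv]] := above p; exists u.
- move=> S S' [u [Au up uS]] [u' [Au' up' uS']].
  exists (fun x => Num.max (u x) (u' x)); split.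
  + exact: uniform_algebra_max.
  + by move=> z; rewrite ge_max up up'.
  + by move=> z [/uS|/uS'] uz; rewrite le_max uz ?orbT.
- by move=> S S' SS [u [Au up uS]]; exists u; split => // z /SS /uS.
- move=> q _; have [u [Au uq uv]] := above q.
  exists [set z | `|u z - v z| <= e]; first exact: near_le.
  by exists u; split => // z /=; rewrite ler_norml; lra.
Qed.

End StoneWeierstrass.

(** * The compactification of a closed subalgebra *)

Lemma uniform_algebra_continuous {R : realType} {T : topologicalType} :
  uniform_algebra [set u : T -> R | continuous u].
Proof.
split=> [|a u v cu cv|u v cu cv|u uA] /=.
- exact: cst_continuous.
- move=> x; apply: cvgD; last exact: cv.
  by apply: cvgM; [exact: cvg_cst|exact: cu].
- by move=> x; apply: cvgM; [exact: cu|exact: cv].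
- apply: nbhs_norm_continuous => q e e0.
  have e3 : 0 < e / 3 by rewrite divr_gt0.
  have [w cw uw] := uA _ e3.
  have /cvgrPdist_le/(_ _ e3) := cw q; apply: filterS => p.
  by have := uw p; have := uw q; rewrite !ler_norml; lra.
Qed.

Lemma continuous_into_ptws {I : eqType} {R Y : topologicalType}
    (h : Y -> {ptws I -> R}) :
  (forall a, continuous (fun y => h y a)) -> continuous h.
Proof.
move=> ch y; apply/cvg_sup => a U [V [[W oW <-] /= Wy] WU].
apply: filterS WU _; apply: (ch a y).
by apply: open_nbhs_nbhs.
Qed.

Lemma continuous_into_set_type {T Y : topologicalType} (B : set T) (h : Y ->
  B) :
  continuous (fun y => set_val (h y)) -> continuous h.
Proof.
move=> ch y U [V [[W oW <-] /= Wy] WU].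
by apply: filterS WU _; apply: ch; apply: open_nbhs_nbhs.
Qed.

Lemma compact_set_type {T : topologicalType} (B : set T) :
  compact B -> compact [set: B].
Proof.
move=> cB F FF _.
have [|p [Bp clp]] := cB (set_val @ F) (fmap_proper_filter _ FF).
  by apply: (@filterS _ F _ setT); [move=> x _;
    exact: set_mem (valP x)|exact: filterT].
exists (SigSub (mem_set Bp)); split => // S U FS [V [[W oW <-] /= Wp] WU].
have FS' : (set_val @ F) [set x | exists2 s, S s & set_val s = x].
  by apply: (@filterS _ F _ S) => // s Ss; exists s.
have [_ [[s Ss <-] Ws]] := clp _ _ FS' (open_nbhs_nbhs (conj oW Wp)).
by exists s; split => //; exact: WU.
Qed.

Lemma hausdorff_separated {R : realType} {T : topologicalType} :
  (forall p q : T, p <> q -> exists2 v : T -> R, continuous v & v p <> v q) ->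
  hausdorff_space T.
Proof.
move=> sep p q clpq; apply: contrapT => /sep[v cv]; apply.
apply: (@Rhausdorff R) => U V vU vV.
by have [x [? ?]] := clpq _ _ (cv p _ vU) (cv q _ vV); exists (v x).
Qed.

(** The image of a compact set is closed and misses [q], so points of [X] near [q] lie outside that
    set, where [v] is small. *)
Lemma vanishing_boundary {R : realType} {X T : topologicalType} (i : X -> T)
    (v : T -> R) q : hausdorff_space T -> continuous i -> continuous v ->
  (forall U, nbhs q U -> exists x, U (i x)) ->
  vanishing (v \o i) -> ~ range i q -> v q = 0.
Proof.
move=> hsT ci cv dq v0 nq; apply/eqP; rewrite -normr_eq0 eq_le normr_ge0 andbT.
apply/ler_addgt0Pl => e e0; rewrite addr0 leNgt; apply/negP => vq.
have [K cK vK] := v0 _ e0.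
have : nbhs q (~` (i @` K)).
  apply: open_nbhs_nbhs; split; last by move=> [x _ xq]; apply: nq; exists x.
  apply: closed_openC; apply: compact_closed => //.
  by apply: continuous_compact => //; exact: continuous_subspaceT.
have : nbhs q [set p | e < `|v p|].
  by apply: (cvgr_gt `|v q|) => //; apply: cvg_norm; exact: cv.
move=> /filterI /[apply] /dq[x /= [vx nKx]].
have : `|v (i x)| <= e by apply: vK => Kx; apply: nKx; exists x.
by rewrite leNgt vx.
Qed.

Section Compactification.
Context {R : realType} {X : topologicalType} (A : set (X -> R)).
Hypothesis hsX : hausdorff_space X.
Hypothesis bA : A `<=` @bounded_continuous R X.
Hypothesis uA : uniform_algebra A.
Hypothesis bumpA : forall x U, nbhs x U ->
  exists2 u, A u & u x = 1 /\ forall y, ~ U y -> u y = 0.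

Definition evaluation (x : X) : {ptws A -> R} := fun a => set_val a x.

(** The Gelfand spectrum of [A], realised inside the product of copies of [R] indexed by [A]. *)
Definition spectrum : topologicalType := closure (range evaluation).

Definition spectrum_in (x : X) : spectrum :=
  SigSub (mem_set (subset_closure (imageT evaluation x))).

(** The continuous extension of [u] to the spectrum, that is, its Gelfand transform. *)
Definition coordinate u (Au : A u) (q : spectrum) : R :=
  set_val q (SigSub (mem_set Au)).

Lemma coordinate_continuous u (Au : A u) : continuous (coordinate Au).
Proof.
move=> q; apply: (@continuous_comp spectrum {ptws A -> R} R set_val
  (fun p => p (SigSub (mem_set Au)))); first exact: initial_continuous.
exact: (@proj_continuous _ (fun _ : A => R)).
Qed.

Lemma coordinate_in u (Au : A u) x : coordinate Au (spectrum_in x) = u x.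
Proof. by []. Qed.

Lemma coordinate_eq (p q : spectrum) :
  (forall u (Au : A u), coordinate Au p = coordinate Au q) -> p = q.
Proof.
case: p q => [p Pp] [q Qq] pq; suff E : p = q.
  by move: Qq {pq}; rewrite -E => Pp'; congr exist; exact: Prop_irrelevance.
apply/funext => -[u uA'] /=; have := pq u (set_mem uA'); rewrite /coordinate.
by have -> : mem_set (set_mem uA') = uA' by exact: Prop_irrelevance.
Qed.

Lemma continuous_into_spectrum {Y : topologicalType} (h : Y -> spectrum) :
  (forall u (Au : A u), continuous (fun y =>
    coordinate Au (h y))) -> continuous h.
Proof.
move=> ch; apply: continuous_into_set_type; apply: continuous_into_ptws.
move=> -[u uA']; have := ch u (set_mem uA'); rewrite /coordinate.
by have -> : mem_set (set_mem uA') = uA' by exact: Prop_irrelevance.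
Qed.

Lemma spectrum_in_continuous : continuous spectrum_in.
Proof.
by apply: continuous_into_spectrum => u Au; have [cu _] := bA Au.
Qed.

(** Bounds on the functions place the evaluations in a product of segments, compact by Tychonoff. *)
Lemma spectrum_compact : compact [set: spectrum].
Proof.
apply: compact_set_type.
have /choice[M MP] : forall a : A, exists M, forall x, `|set_val a x| <= M.
  by move=> [u uA']; have /bA/bounded_continuousP[_ ?] := set_mem uA'.
pose B := [set p : {ptws A -> R} | forall a, `[- M a, M a]%classic (p a)].
have cB : compact B.
  apply: (@tychonoff A (fun=> R) (fun a => `[- M a, M a]%classic)) => a.
  exact: segment_compact.
apply: (subclosed_compact _ cB); first exact: closed_closure.
have clB : closed B.
  by apply: compact_closed => //; apply: hausdorff_product => a;
    exact: Rhausdorff.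
rewrite closureE => p; apply; split => // _ [x _ <-] a.
rewrite /= in_itv /= -ler_norml.
exact: MP.
Qed.

Lemma spectrum_separated (p q : spectrum) : p <> q ->
  exists u, exists Au : A u, coordinate Au p <> coordinate Au q.
Proof.
move=> pq; apply: contrapT => npq; apply: pq; apply: coordinate_eq => u Au.
by apply: contrapT => upq; apply: npq; exists u, Au.
Qed.

Lemma spectrum_hausdorff : hausdorff_space spectrum.
Proof.
apply: (@hausdorff_separated R) => p q /spectrum_separated[u [Au upq]].
by exists (coordinate Au) => //; exact: coordinate_continuous.
Qed.

Lemma spectrum_in_dense (q : spectrum) (U : set spectrum) : nbhs q U ->
  exists x, U (spectrum_in x).
Proof.
move=> [V [[W oW <-] /= Wq] WU].
have [_ [[x _ <-] Wx]] := set_mem (valP q) W (open_nbhs_nbhs (conj oW Wq)).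
by exists x; exact: WU.
Qed.

Lemma spectrum_in_inj : injective spectrum_in.
Proof.
move=> x y xy; apply: contrapT => nxy.
have [U Ux nUy] : exists2 U, nbhs x U & ~ U y.
  apply: contrapT => H; apply: nxy; apply: hsX => U V Ux Vy.
  exists y; split; last exact: nbhs_singleton.
  by apply: contrapT => nUy; apply: H; exists U.
have [u Au [ux /(_ _ nUy) uy]] := bumpA Ux.
by have := congr1 (coordinate Au) xy; rewrite !coordinate_in ux uy => /eqP;
  rewrite oner_eq0.
Qed.

Lemma spectrum_proper_compactification : proper_compactification spectrum_in.
Proof.
split; [exact: spectrum_compact|exact: spectrum_hausdorff| |].
  split; first exact: spectrum_in_inj.
  apply/seteqP; split=> [U oU|_ [V oV <-]]; last first.
    by apply: open_comp => // x _; exact: spectrum_in_continuous.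
  (* The open set inducing [U]: some member of [A] that is zero off [U] has an extension nonzero at
     [q]. *)
  exists [set q | exists u, exists Au : A u,
      (forall y, ~ U y -> u y = 0) /\ coordinate Au q != 0].
    rewrite openE => q [u [Au [u0 uq]]].
    have /cvgr_neq0/(_ uq) : coordinate Au p @[p --> q] --> coordinate Au q.
      exact: coordinate_continuous.
    by apply: filterS => p up; exists u, Au.
  apply/seteqP; split=> x.
    move=> [u [Au [u0 /eqP ux]]]; apply: contrapT => /u0; exact: ux.
  move=> Ux; have [u Au [ux u0]] := bumpA (open_nbhs_nbhs (conj oU Ux)).
  by exists u, Au; split => //; rewrite coordinate_in ux oner_eq0.
move=> V [q Vq] oV; have [x Vx] :=
  spectrum_in_dense (open_nbhs_nbhs (conj oV Vq)).
by exists (spectrum_in x); split => //; exists x.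
Qed.

(** The continuous functions on the spectrum whose restriction to [X] is in [A] form a uniform
    algebra containing the coordinates, which separate points; by Stone-Weierstrass they are all
    continuous functions. *)
Lemma spectrum_extendable : extendable spectrum_in = A.
Proof.
apply/seteqP; split=> [u [_ [v cv vu]]|u Au]; last first.
  by split; [exact: bA|exists (coordinate Au) => //;
    exact: coordinate_continuous].
pose B := [set w : spectrum -> R | continuous w /\ A (w \o spectrum_in)].
suff [_ Av] : B v by rewrite -(_ : v \o spectrum_in = u)//; apply/funext => x;
  exact: vu.
have [A1 Al AM clA] := uA.
have [cT lT MT clT] := @uniform_algebra_continuous R spectrum.
apply: stone_weierstrass cv => //.
- exact: spectrum_compact.
- split.
  + by split; [exact: cT|exact: A1].
  + by move=> a w w' [cw Aw] [cw' Aw']; split; [exact: lT|exact: Al].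
  + by move=> w w' [cw Aw] [cw' Aw']; split; [exact: MT|exact: AM].
  + move=> w wB; split.
      by apply: clT => e /wB[w' [cw' _] ww']; exists w'.
    by apply: clA => e /wB[w' [_ Aw'] ww'];
      exists (w' \o spectrum_in) => // x; exact: ww'.
- by move=> w [].
- move=> p q /spectrum_separated[w [Aw wpq]]; exists (coordinate Aw) => //.
  by split => //; exact: coordinate_continuous.
Qed.

Section Extension.
Context (phi : X -> X).
Hypothesis phiA : forall u, A u -> A (u \o phi).

(** The transpose of composition with [phi]: its [u]-coordinate is the [(u \o phi)]-coordinate of
    [p]. *)
Definition dual_map (p : {ptws A -> R}) : {ptws A -> R} :=
  fun a => p (SigSub (mem_set (phiA (set_mem (valP a))))).

Lemma dual_map_continuous : continuous dual_map.
Proof.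
apply: continuous_into_ptws => a; exact: (@proj_continuous _ (fun _ : A => R)).
Qed.

Lemma dual_map_closure (q : spectrum) :
  closure (range evaluation) (dual_map (set_val q)).
Proof.
move=> U /dual_map_continuous nU.
have [_ [[x _ <-] Ux]] := set_mem (valP q) _ nU.
by exists (evaluation (phi x)); split; [exists (phi x)|].
Qed.

Definition spectrum_map (q : spectrum) : spectrum :=
  SigSub (mem_set (@dual_map_closure q)).

Lemma coordinate_map u (Au : A u) q :
  coordinate Au (spectrum_map q) = coordinate (phiA Au) q.
Proof.
rewrite /coordinate /spectrum_map /dual_map /=; congr (set_val q _).
exact: val_inj.
Qed.

Lemma spectrum_map_continuous : continuous spectrum_map.
Proof.
apply: continuous_into_spectrum => u Au.
have -> : (fun q => coordinate Au (spectrum_map q)) = coordinate (phiA Au).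
  by apply/funext => q; exact: coordinate_map.
exact: coordinate_continuous.
Qed.

Lemma spectrum_map_in x : spectrum_map (spectrum_in x) = spectrum_in (phi x).
Proof. by apply: coordinate_eq => u Au; rewrite coordinate_map. Qed.

(** The graph of a continuous map into a Hausdorff space is closed, which gives one inclusion;
    density of [X] gives the other. *)
Lemma extended_relation_graph : continuous phi ->
  extended_relation phi spectrum_in = graph spectrum_map.
Proof.
move=> cphi; apply/seteqP; split=> [[p q]|[p q]]; rewrite /graph /=.
  move=> clpq; apply: spectrum_hausdorff => U V pU qV.
  have nUV : nbhs (p, q) (spectrum_map @^-1` U `*` V).
    by exists (spectrum_map @^-1` U, V) => //; split => //;
      exact: spectrum_map_continuous.
  have [_ [[[x y] + <-] [/= Ux Vx]]] := clpq _ nUV.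
  rewrite /graph /= => xy; exists (spectrum_in y); split => //.
  by rewrite -xy -spectrum_map_in.
move=> <- W [[U V] /= [Up Vp] UVW].
have [x [Ux Vx]] := spectrum_in_dense (filterI Up (spectrum_map_continuous Vp)).
exists (spectrum_in x, spectrum_in (phi x)); split.
  by exists (x, phi x).
by apply: UVW; split => //=; rewrite -spectrum_map_in.
Qed.

End Extension.

Lemma spectrum_mapK f g (fA : forall u, A u -> A (u \o f))
    (gA : forall u, A u -> A (u \o g)) :
  cancel f g -> cancel (spectrum_map fA) (spectrum_map gA).
Proof.
move=> fK q; apply: coordinate_eq => u Au; rewrite !coordinate_map.
rewrite /coordinate; congr (set_val q _); apply: val_inj => /=.
by apply/funext => x /=; rewrite fK.
Qed.

End Compactification.

(** * The algebra generated by Lyapunov functions *)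

Lemma vanishing_approximable {R : realType} {X : topologicalType} :
  uniformly_approximable (@vanishing R X) `<=` vanishing.
Proof.
move=> u uA e e0; have e2 : 0 < e / 2 by rewrite divr_gt0.
have [w wv uw] := uA _ e2; have [K cK wK] := wv _ e2.
by exists K => // x /wK; have := uw x; rewrite !ler_norml; lra.
Qed.

Lemma vanishing_lincomb {R : realType} {X : topologicalType} (a : R) (u v :
  X -> R) :
  vanishing u -> vanishing v -> vanishing (fun x => a * u x + v x).
Proof.
move=> vu vv e e0; have e2 : 0 < e / 2 by rewrite divr_gt0.
(* Adding 1 keeps the divisor positive when [a] is 0. *)
have a1 : 0 < `|a| + 1 by rewrite ltr_wpDl.
have [K cK uK] := vu _ (divr_gt0 e2 a1); have [K' cK' vK'] := vv _ e2.
exists (K `|` K'); first exact: compactU.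
move=> x nKx; have nK : ~ K x by move=> Kx; apply: nKx; left.
have nK' : ~ K' x by move=> Kx; apply: nKx; right.
rewrite (le_trans (ler_normD _ _))// [leRHS]splitr lerD ?vK'//.
rewrite normrM; have := uK _ nK; rewrite ler_pdivlMr//.
by have := normr_ge0 (u x); nra.
Qed.

Lemma vanishing_bounded {R : realType} {X : topologicalType} M (u v : X -> R) :
  (forall x, `|v x| <= M) -> vanishing u -> vanishing (fun x => u x * v x).
Proof.
move=> vM vu e e0.
have M1 : 0 < `|M| + 1 by rewrite ltr_wpDl.
have [K cK uK] := vu _ (divr_gt0 e0 M1); exists K => // x /uK.
rewrite ler_pdivlMr// normrM; apply: le_trans; rewrite ler_wpM2l//.
by rewrite (le_trans (vM x))// (le_trans (ler_norm M))// lerDl.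
Qed.

Section GeneratedAlgebra.
Context {R : realType} {X : topologicalType}.

Lemma bounded_continuous_closed_subalgebra :
  closed_subalgebra (@bounded_continuous R X).
Proof.
have [cT lT MT clT] := @uniform_algebra_continuous R X.
apply/closed_subalgebraP; split => //; split.
- by apply/bounded_continuousP; split; [exact: cT|exists 1 => x;
  rewrite normr1].
- move=> a u v /bounded_continuousP[cu [M uM]] /bounded_continuousP[cv [N vN]].
  apply/bounded_continuousP; split; first exact: lT.
  exists (`|a| * M + N) => x; rewrite (le_trans (ler_normD _ _))// lerD//.
  by rewrite normrM ler_wpM2l.
- move=> u v /bounded_continuousP[cu [M uM]] /bounded_continuousP[cv [N vN]].
  apply/bounded_continuousP; split; first exact: MT.
  by exists (M * N) => x; rewrite normrM ler_pM.
- move=> u uA; apply/bounded_continuousP; split.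
    by apply: clT => e /uA[w /bounded_continuousP[cw _] uw]; exists w.
  have [w /bounded_continuousP[_ [M wM]] uw] := uA 1 ltr01.
  exists (M + 1) => x; have := uw x; have := wM x; rewrite !ler_norml; lra.
Qed.

(** The members are bounded and continuous because [bounded_continuous] is one of the algebras being
    intersected. *)
Lemma generated_closed_subalgebra_closed (S : set (X -> R)) :
  S `<=` @bounded_continuous R X ->
  closed_subalgebra (generated_closed_subalgebra S).
Proof.
move=> bS; split.
- by move=> u; apply; split => //; exact: bounded_continuous_closed_subalgebra.
- by move=> B [[_ B1 _ _ _] _].
- by move=> a u v Au Av B [cB SB]; case: (cB) => _ _ lB _ _; apply: lB;
  [exact: Au|exact: Av].
- by move=> u v Au Av B [cB SB]; case: (cB) => _ _ _ MB _; apply: MB;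
  [exact: Au|exact: Av].
- by apply: closed_bigI => B [[_ _ _ _ clB] _].
Qed.

Lemma compactly_supportedP (K : set X) (u : X -> R) : closed K -> compact K ->
  continuous u -> (forall x, ~ K x -> u x = 0) -> compactly_supported u.
Proof.
move=> clK cK cu u0; split => //; apply: (subclosed_compact _ cK).
  exact: closed_closure.
rewrite closureE => x; apply; split => // y /eqP uy.
by apply: contrapT => /u0.
Qed.

Lemma compactly_supported0 (u : X -> R) : compactly_supported u ->
  exists2 K, compact K & forall x, ~ K x -> u x = 0.
Proof.
move=> [cu cK]; exists (closure [set x | u x != 0]) => // x nKx.
by apply/eqP; apply: contrapT => /negP ux; apply: nKx; exact: subset_closure.
Qed.

Lemma compactly_supported_bounded :
  @compactly_supported R X `<=` @bounded_continuous R X.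
Proof.
move=> u cu; apply/bounded_continuousP; split; first by case: cu.
have [K cK u0] := compactly_supported0 cu.
have [M uM] := compact_continuous_bounded cK (proj1 cu).
exists (Num.max 0 M) => x; rewrite le_max.
by have [/uM ->|/u0 ->] := pselect (K x); rewrite ?orbT// normr0 lexx.
Qed.

Lemma compactly_supported_vanishing : @compactly_supported R X `<=` vanishing.
Proof.
move=> u /compactly_supported0[K cK u0] e e0; exists K => // x /u0 ->.
by rewrite normr0 ltW.
Qed.

(** The functions whose extensions cannot tell a boundary point from its image. *)
Definition asymptotically_invariant (f : X -> X) : set (X -> R) :=
  [set u | bounded_continuous u /\ vanishing (fun x => u (f x) - u x)].

Lemma asymptotically_invariant_closed_subalgebra f :
  closed_subalgebra (asymptotically_invariant f).
Proof.
have /closed_subalgebraP[_ [cT lT MT clT]] :=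
  bounded_continuous_closed_subalgebra.
apply/closed_subalgebraP; split; first by move=> u [].
split.
- split => // e e0; exists set0; first exact: compact0.
  by move=> x _; rewrite subrr normr0 ltW.
- move=> a u v [bu vu] [bv vv]; split; first exact: lT.
  have := vanishing_lincomb a vu vv; congr vanishing.
  by apply/funext => x; ring.
- move=> u v [bu vu] [bv vv]; split; first exact: MT.
  have /bounded_continuousP[_ [M uM]] := bu.
  have /bounded_continuousP[_ [N vN]] := bv.
  (* The increment of [u v] is the increment of [u] times [v \o f] plus [u] times the increment of
     [v]. *)
  have := vanishing_lincomb 1 (vanishing_bounded (fun x =>
    vN (f x)) vu) (vanishing_bounded uM vv).
  by congr vanishing; apply/funext => x; ring.
- move=> u uA; split; first by apply: clT => e /uA[w [bw _] uw]; exists w.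
  apply: vanishing_approximable => e e0.
  have e2 : 0 < e / 2 by rewrite divr_gt0.
  have [w [_ vw] uw] := uA _ e2; exists (fun x => w (f x) - w x) => // x.
  by have := uw x; have := uw (f x); rewrite !ler_norml; lra.
Qed.

(** If [u] is zero off [K], then [u \o f - u] is zero off the union of [K] and its image under [g],
    which is compact by continuity of [g]. *)
Lemma compactly_supported_asymptotically_invariant (f g : X -> X) :
  continuous g -> cancel f g ->
  @compactly_supported R X `<=` asymptotically_invariant f.
Proof.
move=> cg fK u cu; split; first exact: compactly_supported_bounded.
have [K cK u0] := compactly_supported0 cu => e e0; exists (K `|` (g @` K)).
  apply: compactU => //; apply: continuous_compact => //.
  exact: continuous_subspaceT.
move=> x nKx; rewrite !u0 ?subrr ?normr0 ?ltW// => Kx; apply: nKx;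
  first by left.
by right; exists (f x).
Qed.

End GeneratedAlgebra.

(** * The compactification given by a sufficient set with vanishing increments *)

Section LyapunovCompactification.
Context {R : realType} {X : topologicalType} (f g : X -> X) (Ls : set (X -> R)).
Hypothesis lcX : locally_compact [set: X].
Hypothesis scX : sigma_compact X.
Hypothesis hsX : hausdorff_space X.
Hypothesis cf : continuous f.
Hypothesis cg : continuous g.
Hypothesis fK : cancel f g.
Hypothesis gK : cancel g f.
Hypothesis sLs : sufficient f Ls.
Hypothesis vLs : forall L, Ls L -> vanishing (fun x => L (f x) - L x).

Definition lyapunov_algebra :=
  generated_closed_subalgebra (Ls `|` @compactly_supported R X).

Lemma sub_lyapunov_algebra :
  Ls `|` @compactly_supported R X `<=` lyapunov_algebra.
Proof. by move=> u Su B [_]; exact. Qed.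

Lemma lyapunov_algebra_min B : closed_subalgebra B ->
  Ls `|` @compactly_supported R X `<=` B -> lyapunov_algebra `<=` B.
Proof. by move=> cB SB u; exact. Qed.

Lemma lyapunov_algebra_closed : closed_subalgebra lyapunov_algebra.
Proof.
apply: generated_closed_subalgebra_closed => u [Lu|].
  by have [/(_ _ Lu)[]] := sLs.
exact: compactly_supported_bounded.
Qed.

Lemma lyapunov_algebra_bounded : lyapunov_algebra `<=` @bounded_continuous R X.
Proof. by have [] := lyapunov_algebra_closed. Qed.

Lemma lyapunov_algebra_uniform : uniform_algebra lyapunov_algebra.
Proof. by have /closed_subalgebraP[] := lyapunov_algebra_closed. Qed.

Lemma lyapunov_algebra_asymptotically_invariant :
  lyapunov_algebra `<=` asymptotically_invariant f.
Proof.
apply: lyapunov_algebra_min;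
  first exact: asymptotically_invariant_closed_subalgebra.
move=> u [Lu|]; last exact: (compactly_supported_asymptotically_invariant cg
  fK).
by split; [have [/(_ _ Lu)[]] := sLs|exact: vLs].
Qed.

(** The products [v * phi n] have compact support and approximate [v] uniformly. *)
Lemma vanishing_lyapunov_algebra (v : X -> R) : continuous v -> vanishing v ->
  lyapunov_algebra v.
Proof.
move=> cv vv; have [_ _ _ clA] := lyapunov_algebra_uniform; apply: clA => e e0.
have [K eK _] := exhaustion_exists lcX hsX scX cf.
have [cK _ _] := eK.
have [phi [cphi phi01 phi1 phi0]] := @exhaustion_bump R X lcX hsX K eK.
have [C cC vC] := vv _ e0; have [n Cn] := exhaustion_compact eK cC.
exists (fun x => v x * phi n x).
  apply: sub_lyapunov_algebra; right;
    apply: (@compactly_supportedP _ _ (K n.+1)) => //.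
  - exact: compact_closed.
  - by move=> x; apply: cvgM; [exact: cv|exact: cphi].
  - by move=> x /phi0 ->; rewrite mulr0.
move=> x; have [Cx|/vC vx] := pselect (C x).
  by rewrite phi1 ?mulr1 ?subrr ?normr0 ?ltW//; exact: Cn.
have -> : v x - v x * phi n x = v x * (1 - phi n x) by ring.
have /andP[p0 p1] := phi01 n x.
rewrite normrM [`|1 - _|]ger0_norm ?subr_ge0// (le_trans _ vx)// ler_piMr//.
by rewrite gerBl.
Qed.

(** [u \o f] differs from [u] by a continuous function vanishing at infinity, which the algebra
    contains. *)
Lemma lyapunov_algebra_comp u : lyapunov_algebra u -> lyapunov_algebra (u \o f).
Proof.
move=> Au; have [/bounded_continuousP[cu _] vu] :=
  lyapunov_algebra_asymptotically_invariant Au.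
have := uniform_algebraD lyapunov_algebra_uniform (vanishing_lyapunov_algebra _
  vu) Au.
have H : continuous (fun x => u (f x) - u x).
  by move=> x; apply: cvgB; [apply: continuous_comp;
    [exact: cf|exact: cu]|exact: cu].
by move=> /(_ H); congr lyapunov_algebra; apply/funext => x /=; rewrite subrK.
Qed.

Lemma lyapunov_algebra_comp_inv u : lyapunov_algebra u ->
  lyapunov_algebra (u \o g).
Proof.
move=> Au; have [/bounded_continuousP[cu _] vu] :=
  lyapunov_algebra_asymptotically_invariant Au.
(* This is the increment of [u] along [f] evaluated at [g x], so the image of [K] under [f] is the
   compact set to avoid. *)
have vug : vanishing (fun x => u x - u (g x)).
  move=> e /vu[K cK uK]; exists (f @` K).
    by apply: continuous_compact => //; exact: continuous_subspaceT.
  by move=> x nKx; have := uK (g x); rewrite gK; apply => Kx; apply: nKx;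
    exists (g x).
have cug : continuous (fun x => u x - u (g x)).
  by move=> x; apply: cvgB; [exact: cu|apply: continuous_comp;
    [exact: cg|exact: cu]].
have := uniform_algebraB lyapunov_algebra_uniform Au
  (vanishing_lyapunov_algebra cug vug).
by congr lyapunov_algebra; apply/funext => x /=; rewrite subKr.
Qed.

Lemma lyapunov_algebra_bump x U : nbhs x U ->
  exists2 u, lyapunov_algebra u & u x = 1 /\ forall y, ~ U y -> u y = 0.
Proof.
move=> xU; have [K eK _] := exhaustion_exists lcX hsX scX cf.
have [W Wx [cW WU]] := compact_nbhs_sub lcX hsX xU.
have [| | |u [cu _ u1 u0]] :=
  @exhaustion_urysohn R X K [set x] (~` W°) lcX hsX eK.
- by apply: compact_closed => //; exact: compact_set1.
- by apply: open_closedC; exact: open_interior.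
- by apply/seteqP; split => // a [->]; apply.
have uW y : ~ W y -> u y = 0 by move=> nWy; apply: u0 => /interior_subset.
exists u; last by split; [exact: u1|move=> y nUy; apply: uW => /WU].
apply: sub_lyapunov_algebra; right; apply: (compactly_supportedP _ cW) => //.
exact: compact_closed.
Qed.

Let Xh := spectrum lyapunov_algebra.
Let i : X -> Xh := @spectrum_in R X lyapunov_algebra.

Lemma spectrum_lyapunov_compactification : lyapunov_compactification R f i.
Proof.
split; last first.
  exists Ls => //; apply: spectrum_extendable => //.
  - exact: lyapunov_algebra_bounded.
  - exact: lyapunov_algebra_uniform.
apply: spectrum_proper_compactification => //.
- exact: lyapunov_algebra_bounded.
- exact: lyapunov_algebra_bump.
Qed.

Lemma spectrum_homeomorphism_relation :
  homeomorphism_relation (extended_relation f i).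
Proof.
exists (spectrum_map lyapunov_algebra_comp);
  last exact: extended_relation_graph.
split; first exact: spectrum_map_continuous.
exists (spectrum_map lyapunov_algebra_comp_inv); split.
- exact: spectrum_mapK.
- exact: spectrum_mapK.
- exact: spectrum_map_continuous.
Qed.

(** For every [u] in the algebra the extension of [u \o f - u] is zero at boundary points, so [q]
    and its image have the same coordinates. *)
Lemma spectrum_boundary_fixed :
  ~` range i `<=` fixed_points (extended_relation f i).
Proof.
move=> q nq; rewrite /fixed_points /= (extended_relation_graph
  lyapunov_algebra_comp)//.
rewrite /graph /=; apply: coordinate_eq => u Au; rewrite coordinate_map.
apply/eqP; rewrite -subr_eq0; apply/eqP.
pose v p := coordinate (lyapunov_algebra_comp Au) p - coordinate Au p.
apply: (@vanishing_boundary R X Xh i v q) => //.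
- exact: spectrum_hausdorff.
- exact: spectrum_in_continuous lyapunov_algebra_bounded.
- have cc w (Aw : lyapunov_algebra w) := @coordinate_continuous R X _ w Aw.
  exact: (uniform_algebraB uniform_algebra_continuous (cc _ _) (cc _ _)).
- exact: spectrum_in_dense.
- by have [] := lyapunov_algebra_asymptotically_invariant Au.
Qed.

End LyapunovCompactification.

(** * Metrizability *)

Section SupMetric.
Context {R : realType} {T : choiceType} (h : nat -> T -> R).
Hypothesis h_sep : forall p q, (forall n, h n p = h n q) -> p = q.

Let term p q n := Num.min n.+1%:R^-1 `|h n p - h n q|.

(** A supremum replaces the usual weighted series; truncating the term [n] at [1 / (n + 1)] makes
    the tails uniformly small. *)
Definition sup_dist p q := sup (range (term p q)).

Lemma sup_dist_ub p q n : term p q n <= sup_dist p q.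
Proof.
apply: ub_le_sup; last by exists n.
exists 1 => _ [m _ <-]; rewrite ge_min invf_le1 ?ltr0n// ler1n//.
Qed.

Lemma sup_dist_le p q c : (forall n, term p q n <= c) -> sup_dist p q <= c.
Proof.
move=> tc; apply: ge_sup; first by exists (term p q 0%N); exists 0%N.
by move=> _ [n _ <-].
Qed.

Lemma sup_distxx p : sup_dist p p = 0.
Proof.
have t0 n : term p p n = 0 by rewrite /term subrr normr0 min_r.
apply/eqP; rewrite eq_le -{2}(t0 0%N) sup_dist_ub andbT.
by apply: sup_dist_le => n; rewrite t0.
Qed.

Lemma sup_dist_positivity p q : sup_dist p q = 0 -> p = q.
Proof.
move=> pq; apply: h_sep => n; have := sup_dist_ub p q n.
rewrite pq /term ge_min leNgt invr_gt0 ltr0n/= normr_le0 subr_eq0.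
by move/eqP.
Qed.

Lemma sup_dist_sym p q : sup_dist p q = sup_dist q p.
Proof.
rewrite /sup_dist; have -> // : term p q = term q p.
by apply/funext => n; rewrite /term distrC.
Qed.

Lemma sup_dist_triangle q p r : sup_dist p r <= sup_dist p q + sup_dist q r.
Proof.
apply: sup_dist_le => n;
  apply: le_trans (lerD (sup_dist_ub p q n) (sup_dist_ub q r n)).
rewrite /term; set c := n.+1%:R^-1; have c0 : 0 <= c by rewrite invr_ge0.
have := ler_distD (h n q) (h n p) (h n r).
set a := `|h n p - h n q|; set b := `|h n q - h n r| => ab.
have a0 : 0 <= a by exact: normr_ge0.
have b0 : 0 <= b by exact: normr_ge0.
rewrite ge_min; case: (leP c a) => ca; case: (leP c b) => cb; apply/orP; lra.
Qed.

(* The separation property is a parameter of the alias so that its metric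
   structure can be inferred. *)
Definition sup_metric of (forall p q, (forall n, h n p = h n q) ->
  p = q) : Type := T.

HB.instance Definition _ := Choice.on (sup_metric h_sep).
HB.instance Definition _ := isMetric.Build R (sup_metric h_sep)
  sup_distxx sup_dist_positivity sup_dist_sym sup_dist_triangle.

End SupMetric.

(** The identity onto the metric space is a continuous bijection from a compact space to a Hausdorff
    one, hence a homeomorphism. *)
Lemma compact_metrizable {R : realType} {T : topologicalType} (h : nat ->
  T -> R) :
  compact [set: T] -> (forall n, continuous (h n)) ->
  (forall p q, (forall n, h n p = h n q) -> p = q) -> metrizable R T.
Proof.
move=> cT ch sep; pose M : metricType R := sup_metric sep.
exists M, (id : T -> M).
have cid' : continuous (id : T -> M).
  move=> p; apply/metricType_numDomainType.cvgrPdist_le => e e0.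
  have nearN N : \forall q \near p, forall n, (n < N)%N ->
    `|h n p - h n q| <= e.
    elim: N => [|N IH]; first by apply: nearW.
    have /cvgrPdist_le/(_ e e0) := ch N p.
    apply: filterS2 IH => q hq hN n; rewrite ltnS leq_eqVlt => /orP[/eqP ->//|].
    exact: hq.
  (* Terms of index beyond [1 / e] are below [e] by truncation, so finitely many coordinates remain
     to be controlled. *)
  apply: filterS (nearN (Num.truncn e^-1).+1) => q hq.
  apply: sup_dist_le => n; rewrite ge_min.
  have [nN|Nn] := ltnP n (Num.truncn e^-1).+1; first by rewrite hq ?orbT.
  rewrite -[leRHS]invrK lef_pV2 ?posrE ?invr_gt0//.
  by rewrite (le_trans (ltW (truncnS_gt _)))// ler_nat ltnW.
split => //; exists (id : M -> T); split => //.
apply/continuous_closedP => C clC.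
have -> : (id : M -> T) @^-1` C = (id : T -> M) @` C.
  by apply/seteqP; split => [x ?|_ [x ? <-]//]; exists x.
apply: compact_closed; first exact: metric_hausdorff.
apply: continuous_compact; first exact: continuous_subspaceT.
exact: (subclosed_compact clC cT).
Qed.

Lemma continuous_dist {R : realType} {T : topologicalType} (u v : T -> R) :
  continuous u -> continuous v -> continuous (fun x => `|u x - v x|).
Proof. by move=> cu cv x; apply: cvg_norm; apply: cvgB;
  [exact: cu|exact: cv]. Qed.

Lemma continuous_dense_le {R : realType} {X T : topologicalType} (i : X -> T)
    (v : T -> R) q c : continuous v -> (forall U, nbhs q U ->
      exists x, U (i x)) ->
  (forall x, v (i x) <= c) -> v q <= c.
Proof.
move=> cv dq vc; rewrite leNgt; apply/negP => cvq.
by have /(cvgr_gt (v q))/(_ _ cvq)/dq[x /=] := cv q; rewrite ltNge vc.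
Qed.

Section SpectrumCoordinates.
Context {R : realType} {X : topologicalType} (A : set (X -> R)).
Hypothesis uA : uniform_algebra A.

Lemma coordinate_near u v e (Au : A u) (Av : A v) q :
  (forall x, `|u x - v x| <= e) -> `|coordinate Au q - coordinate Av q| <= e.
Proof.
move=> uv; apply: (continuous_dense_le (i := @spectrum_in R X A)
  (v := fun q => `|coordinate Au q - coordinate Av q|)) => //.
  by apply: continuous_dist; exact: coordinate_continuous.
exact: spectrum_in_dense.
Qed.

(** Extensions from the dense image of [X] are unique; this is how coordinates are shown to respect
    the algebra operations. *)
Lemma coordinate_unique u v (Au : A u) (v_ : spectrum A ->
  R) q : continuous v_ ->
  (forall x, v_ (spectrum_in A x) = v x) -> u = v -> coordinate Au q = v_ q.
Proof.
move=> cv vE uv; apply/eqP; rewrite -subr_eq0 -normr_le0.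
apply: (continuous_dense_le (i := @spectrum_in R X A)
  (v := fun q => `|coordinate Au q - v_ q|)) => [|U|x].
- by apply: continuous_dist => //; exact: coordinate_continuous.
- exact: spectrum_in_dense.
- by rewrite coordinate_in vE uv subrr normr0.
Qed.

(** It lets agreement at [p] and [q] be checked on generators only. *)
Lemma coordinate_agree_algebra (p q : spectrum A) : uniform_algebra
  [set u | exists Au : A u, coordinate Au p = coordinate Au q].
Proof.
have [A1 lA MA clA] := uA;
  have [cT lT MT _] := @uniform_algebra_continuous R (spectrum A).
split.
- exists A1; have E r := @coordinate_unique _ _ A1 _ r cT (fun=> erefl) erefl.
  by rewrite !E.
- move=> a u v [Au upq] [Av vpq]; exists (lA a _ _ Au Av).
  have E r := @coordinate_unique _ _ (lA a _ _ Au Av) _ r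
    (lT a _ _ (coordinate_continuous (Au :=
      Au)) (coordinate_continuous (Au := Av))) (fun=> erefl) erefl.
  by rewrite !E upq vpq.
- move=> u v [Au upq] [Av vpq]; exists (MA _ _ Au Av).
  have E r := @coordinate_unique _ _ (MA _ _ Au Av) _ r
    (MT _ _ (coordinate_continuous (Au := Au)) (coordinate_continuous (Au :=
      Av))) (fun=> erefl) erefl.
  by rewrite !E upq vpq.
- move=> u uE; have Au : A u by apply: clA => e /uE[w [Aw _] uw]; exists w.
  exists Au; apply/eqP; rewrite -subr_eq0 -normr_le0;
    apply/ler_addgt0Pl => e e0.
  have e2 : 0 < e / 2 by rewrite divr_gt0.
  have [w [Aw wpq] uw] := uE _ e2; rewrite addr0.
  have := coordinate_near Au Aw p uw; have := coordinate_near Au Aw q uw.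
  by rewrite wpq !ler_norml; lra.
Qed.

End SpectrumCoordinates.

(** * Distances and countable bases on a metrizable sigma-compact space *)

Lemma metrizable_distance {R : realType} {X : topologicalType} :
  metrizable R X ->
  exists d : X -> X -> R, [/\ forall x y, d x y = 0 -> x = y,
    forall x y, d x y = d y x, forall x y z, d x z <= d x y + d y z,
    forall x y, 0 <= d x y &
    forall x U, nbhs x U <-> exists2 r, 0 < r & forall y, d x y < r -> U y].
Proof.
move=> [M [h [ch [k [hK kK ck]]]]].
exists (fun x y => mdist (h x) (h y)); split.
- by move=> x y /mdist_positivity/(can_inj hK).
- by move=> x y; exact: metric_sym.
- by move=> x y z; exact: metric_triangle.
- by move=> x y; exact: mdist_ge0.
move=> x U; split=> [xU|[r r0 rU]].
  have : nbhs (h x) (k @^-1` U) by apply: ck; rewrite hK.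
  rewrite -metricType_numDomainType.filter_from_mdist_nbhs => -[r r0 rU].
  by exists r => // y /rU /=; rewrite hK.
have : nbhs x (h @^-1` [set z | mdist (h x) z < r]).
  by apply: ch; rewrite -metricType_numDomainType.filter_from_mdist_nbhs;
    exists r.
by apply: filterS => y; exact: rU.
Qed.

Section Metric.
Context {R : realType} {X : topologicalType} (d : X -> X -> R).
Hypothesis d_sym : forall x y, d x y = d y x.
Hypothesis d_triangle : forall x y z, d x z <= d x y + d y z.
Hypothesis d_nbhs : forall x U, nbhs x U <-> exists2 r, 0 < r &
  forall y, d x y < r -> U y.
Hypothesis scX : sigma_compact X.

Lemma dist_continuous c : continuous (d c).
Proof.
apply: nbhs_norm_continuous => x e e0; apply/d_nbhs; exists e => // y xy.
have := d_triangle c x y; have := d_triangle c y x;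
  rewrite (d_sym y x) ler_norml; lra.
Qed.

(* [None] is only needed for an empty space. *)
Lemma sigma_compact_dense : exists D : nat * nat * nat -> option X,
  forall x e, 0 < e -> exists j, exists2 c, D j = Some c & d c x < e.
Proof.
have [K [cK KT]] := scX.
have /choice[s sP] : forall nm : nat * nat, exists s : seq X,
    forall x, K nm.1 x -> exists2 c, c \in s & d c x < nm.2.+1%:R^-1.
  move=> [n m] /=; apply: (compact_union_ind (P := fun S => exists s : seq X,
    forall x, S x -> exists2 c, c \in s & d c x < m.+1%:R^-1)) => //.
  - by exists [::].
  - move=> S S' [s sP] [s' sP']; exists (s ++ s') => x [/sP|/sP'] [c cs cx];
      by exists c => //; rewrite mem_cat cs ?orbT.
  - by move=> S S' SS [s sP]; exists s => x /SS /sP.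
  - move=> x _; exists [set y | d x y < m.+1%:R^-1].
      by apply/d_nbhs; exists m.+1%:R^-1; rewrite ?invr_gt0.
    by exists [:: x] => y xy; exists x; rewrite ?inE.
(* The index [(n, m, k)] names the [k]-th point of a finite net of mesh [1 / (m + 1)] for the [n]-th
   compact set. *)
exists (fun nmk => nth None (map Some (s nmk.1)) nmk.2) => x e e0.
have [n _ Kx] : (\bigcup_n K n) x by rewrite KT.
have [c cs cx] := sP (n, Num.truncn e^-1) x Kx.
exists (n, Num.truncn e^-1, index c (s (n, Num.truncn e^-1))), c.
  by rewrite /= (nth_map c) ?index_mem// nth_index.
apply: lt_le_trans cx _; rewrite -[leRHS]invrK lef_pV2 ?posrE ?invr_gt0//.
exact: ltW (truncnS_gt _).
Qed.

Definition rational_ball (D : nat * nat * nat ->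
  option X) (b : nat * nat * nat * nat) :=
  [set x | exists2 c, D b.1 = Some c & d c x < b.2.+1%:R^-1].

Lemma rational_ball_base D x U :
  (forall x e, 0 < e -> exists j, exists2 c, D j = Some c & d c x < e) ->
  nbhs x U -> exists2 b, rational_ball D b x & rational_ball D b `<=` U.
Proof.
(* With [m + 1] beyond [2 / r], twice the radius [1 / (m + 1)] fits into [r]. *)
move=> DP /d_nbhs[r r0 rU]; set m := Num.truncn (2 / r).
have m0 : 0 < m.+1%:R^-1 :> R by rewrite invr_gt0.
have [j [c jc cx]] := DP x _ m0; exists (j, m); first by exists c.
move=> y [c' /=]; rewrite jc => -[<-] /= cy; apply: rU.
have : m.+1%:R^-1 + m.+1%:R^-1 <= r.
  have : 2 / r <= m.+1%:R by exact: ltW (truncnS_gt _).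
  have -> : m.+1%:R^-1 + m.+1%:R^-1 = 2 / m.+1%:R :> R by rewrite -mulr2n
    -[LHS]mulr_natl.
  by rewrite !ler_pdivrMr// mulrC.
move: (d_triangle x c y); rewrite (d_sym x c) => xy mr.
by apply: le_lt_trans xy _; apply: lt_le_trans mr; exact: ltrD.
Qed.

End Metric.

(** * Countable sufficient sets and metrizability of the compactification *)

Lemma sufficient_separating {R : realType} {X : topologicalType} (f : X -> X)
    (Ls : set (X -> R)) : Ls `<=` @lyapunov R X f ->
  (forall x y, ~ recurrence_order f (x, y) -> exists2 L, Ls L & L y < L x) ->
  sufficient f Ls.
Proof.
move=> lLs sep; split => //; apply/seteqP; split=> [[x y] xy L LL|[x y] xy].
  by apply: lyapunov_recurrence_order xy; exact: lLs.
apply: contrapT => /sep[L LL]; rewrite ltNge => /negP; apply; exact: (xy L LL).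
Qed.

(** For each pair of basic sets one admissible function separating them is chosen, if there is any.
    A function separating [x] from [y] separates basic neighbourhoods of them at its middle value,
    so the function chosen for these does too. *)
Lemma countable_sufficient {R : realType} {X : topologicalType} (f : X -> X)
    (B : countType) (base : B -> set X) :
  locally_compact [set: X] -> sigma_compact X -> hausdorff_space X ->
    continuous f ->
  (forall x U, nbhs x U -> exists2 b, base b x & base b `<=` U) ->
  exists lam : B * B -> X -> R,
    sufficient f (range lam) /\ forall b, vanishing (fun x =>
      lam b (f x) - lam b x).
Proof.
move=> lcX scX hsX cf baseP.
pose admissible (L : X -> R) := lyapunov f L /\ vanishing (fun x =>
  L (f x) - L x).
pose good bb (L : X -> R) :=
  forall x y, base bb.1 x -> base bb.2 y -> L y < L x.
(* The default for pairs of basic sets that no admissible function separates. *)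
have adm0 : admissible (cst 0).
  split; last first.
    move=> e e0; exists set0; first exact: compact0.
    by move=> x _; rewrite subrr normr0 ltW.
  split=> //; have /closed_subalgebraP[_ uB] :=
    @bounded_continuous_closed_subalgebra R X.
  exact: uniform_algebra_cst.
have /choice[lam lamP] : forall bb, exists L, admissible L /\
    forall L', admissible L' -> good bb L' -> good bb L.
  move=> bb; have [[L [aL gL]]|nL] :=
    pselect (exists L, admissible L /\ good bb L).
    by exists L.
  by exists (cst 0); split => // L' aL' gL'; exfalso; apply: nL; exists L'.
exists lam; split; last by move=> b; have [[]] := lamP b.
apply: sufficient_separating; first by move=> _ [b _ <-]; have [[]] := lamP b.
move=> x y /(vanishing_lyapunov_separates (R :=
  R) lcX scX hsX cf)[L [lL vL Lyx]].
have [[cL _] _] := lL; pose m := (L x + L y) / 2.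
have xm : nbhs x [set z | m < L z] by apply: (cvgr_gt (L x) (cL x));
  rewrite /m; lra.
have ym : nbhs y [set z | L z < m] by apply: (cvgr_lt (L y) (cL y));
  rewrite /m; lra.
have [a ax am] := baseP _ _ xm; have [b bY bm] := baseP _ _ ym.
exists (lam (a, b)); first by exists (a, b).
have [_ /(_ L)] := lamP (a, b); apply => // z w /am /= mz /bm /= wm.
exact: lt_trans mz.
Qed.

Lemma spectrum_metrizable {R : realType} {X : topologicalType} (A :
  set (X -> R))
    (I : countType) (F : I -> X -> R) (FA : forall i, A (F i)) :
  A `<=` @bounded_continuous R X ->
  (forall p q : spectrum A,
    (forall i, coordinate (FA i) p = coordinate (FA i) q) -> p = q) ->
  metrizable R (spectrum A).
Proof.
move=> bA sep.
pose h n (p : spectrum A) :=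
  if unpickle n is Some i then coordinate (FA i) p else 0.
apply: (@compact_metrizable R _ h).
- exact: spectrum_compact.
- move=> n; rewrite /h; case: unpickle => [i|];
  first exact: coordinate_continuous.
  exact: cst_continuous.
- by move=> p q hpq; apply: sep => i; have := hpq (pickle i);
  rewrite /h pickleK.
Qed.

Section MetrizableSpectrum.
Context {R : realType} {X : topologicalType} (A : set (X ->
  R)) (Ls : set (X -> R)).
Hypothesis bA : A `<=` @bounded_continuous R X.
Hypothesis uA : uniform_algebra A.
Hypothesis LsA : Ls `<=` A.
Hypothesis ccA : @compactly_supported R X `<=` A.
Hypothesis minA : forall B, closed_subalgebra B ->
  Ls `|` @compactly_supported R X `<=` B -> A `<=` B.

Lemma coordinate_compactly_supported0 u (Au : A u) q : compactly_supported u ->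
  ~ range (@spectrum_in R X A) q -> coordinate Au q = 0.
Proof.
move=> cu nq; apply: (@vanishing_boundary R X _ (@spectrum_in R X A)
  (coordinate Au) q) => //.
- exact: spectrum_hausdorff.
- exact: spectrum_in_continuous.
- exact: coordinate_continuous.
- exact: spectrum_in_dense.
- exact: compactly_supported_vanishing.
Qed.

(** The members of [A] that agree at [p] and [q] form a closed subalgebra; it contains [Ls] by
    assumption and the compactly supported functions because these are zero at both points, so it is
    all of [A]. *)
Lemma boundary_separated (p q : spectrum A) :
  ~ range (@spectrum_in R X A) p -> ~ range (@spectrum_in R X A) q ->
  (forall L (LL : Ls L), coordinate (LsA LL) p = coordinate (LsA LL) q) ->
    p = q.
Proof.
move=> np nq Lpq; apply: coordinate_eq => u Au.
suff : A `<=` [set u | exists Au : A u, coordinate Au p = coordinate Au q].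
  move=> /(_ u Au)[Au' upq]; by have -> : Au = Au' by exact: Prop_irrelevance.
apply: minA.
  apply/closed_subalgebraP; split; first by move=> w [Aw _]; exact: bA.
  exact: coordinate_agree_algebra.
move=> w [Lw|cw]; first by exists (LsA Lw).
by exists (ccA cw); rewrite !coordinate_compactly_supported0.
Qed.

End MetrizableSpectrum.

Section MetrizableLyapunovCompactification.
Context {R : realType} {X : topologicalType} (f : X -> X).
Hypothesis lcX : locally_compact [set: X].
Hypothesis scX : sigma_compact X.
Hypothesis hsX : hausdorff_space X.

Lemma lyapunov_algebra_metrizable (I : countType) (lam : I -> X -> R) :
  metrizable R X -> sufficient f (range lam) ->
  metrizable R (spectrum (lyapunov_algebra (range lam))).
Proof.
move=> metX sLs; set A := lyapunov_algebra _.
have bA : A `<=` @bounded_continuous R X := lyapunov_algebra_bounded sLs.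
have uA : uniform_algebra A := lyapunov_algebra_uniform sLs.
have subA := @sub_lyapunov_algebra R X (range lam).
have [d [d_pos d_sym d_tri d_ge0 d_nbhs]] := metrizable_distance metX.
have [D DP] := sigma_compact_dense d_nbhs scX.
have [K eK _] := exhaustion_exists lcX hsX scX (fun x => cvg_id).
have [cK sK KT] := eK.
have [phi [cphi phi01 phi1 phi0]] := @exhaustion_bump R X lcX hsX K eK.
have cc n u : continuous u -> compactly_supported (fun x => phi n x * u x).
  move=> cu; apply: (compactly_supportedP _ (cK n.+1)).
  - exact: compact_closed.
  - by move=> x; apply: cvgM; [exact: cphi|exact: cu].
  - by move=> x /phi0 ->; rewrite mul0r.
pose dist (j : nat * nat * nat) := if D j is Some c then d c else cst 0.
have cdist j : continuous (dist j).
  rewrite /dist; case: (D j) => [c|]; first exact: dist_continuous.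
  exact: cst_continuous.
(* Three countable families: [lam] separates boundary points from each other, the cutoffs separate
   [X] from the boundary, and the cut-off distances separate points of [X]. *)
pose F (a : I + (nat + nat * (nat * nat * nat))) : X -> R := match a with
  | inl b => lam b
  | inr (inl n) => fun x => phi n x * cst 1 x
  | inr (inr (n, j)) => fun x => phi n x * dist j x
  end.
have FA a : A (F a).
  apply: subA; case: a => [b|[n|[n j]]]; first by left; exists b.
  - by right; apply: cc; exact: cst_continuous.
  - by right; apply: cc; exact: cdist.
apply: (spectrum_metrizable (FA := FA)) => // p q pq.
have ccA : @compactly_supported R X `<=` A by move=> u cu; apply: subA; right.
have inside (r s : spectrum A) x : (forall a,
  coordinate (FA a) r = coordinate (FA a) s) ->
    r = spectrum_in A x -> range (@spectrum_in R X A) s.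
  move=> rs rx; apply: contrapT => ns.
  have [n _ Kx] : (\bigcup_n K n) x by rewrite KT.
  have := rs (inr (inl n)); rewrite rx coordinate_in /= phi1// mulr1.
  rewrite (coordinate_compactly_supported0 bA _ _ ns) => [/eqP|];
    first by rewrite oner_eq0.
  by apply: cc; exact: cst_continuous.
have [[x _ xp]|np] := pselect (range (@spectrum_in R X A) p); last first.
  have nq : ~ range (@spectrum_in R X A) q.
    by move=> [x _ xq]; apply: np; apply: (inside q p x).
  have LsA : range lam `<=` A by move=> u Lu; apply: subA; left.
  apply: (boundary_separated bA uA (LsA := LsA) ccA) => //.
    exact: lyapunov_algebra_min.
  move=> L LL; have [b _ bL] := LL; subst L.
  have := pq (inl b); rewrite /F.
  by have -> : FA (inl b) = LsA _ LL by exact: Prop_irrelevance.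
have [y _ yq] := inside p q x pq (esym xp).
rewrite -xp -yq; congr spectrum_in; apply: d_pos; apply: contrapT => /eqP dxy.
have {}dxy : 0 < d x y by rewrite lt_neqAle eq_sym dxy d_ge0.
(* Such a [c] is strictly closer to [x] than to [y], and a cutoff equal to 1 at both points
   preserves the difference. *)
have [j [c jc cx]] := DP x (d x y / 2) ltac:(lra).
have [n _ Kx] : (\bigcup_n K n) x by rewrite KT.
have [m _ Ky] : (\bigcup_n K n) y by rewrite KT.
have := pq (inr (inr (maxn n m, j)));
  rewrite -xp -yq !coordinate_in /F /dist jc !phi1 ?mul1r.
- by have := d_tri x c y; rewrite (d_sym x c); lra.
- by apply: exhaustion_mono Ky => //; exact: leq_maxr.
- by apply: exhaustion_mono Kx => //; exact: leq_maxl.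
Qed.

End MetrizableLyapunovCompactification.

(** * Assembly of the general and the metrizable compactification *)

Theorem theorem5p9 (R : realType) (X : topologicalType) (f : X -> X)
    (lcX : locally_compact [set: X]) (scX : sigma_compact X)
    (hsX : hausdorff_space X) (hf : homeomorphism f) :
  (exists (Xh : topologicalType) (i : X -> Xh),
     [/\ lyapunov_compactification R f i,
         homeomorphism_relation (extended_relation f i) &
         ~` range i `<=` fixed_points (extended_relation f i)]) /\
  (metrizable R X ->
   exists (Xh : topologicalType) (i : X -> Xh),
     [/\ lyapunov_compactification R f i,
         homeomorphism_relation (extended_relation f i),
         ~` range i `<=` fixed_points (extended_relation f i) &
         metrizable R Xh]).
Proof.
have [cf [g [fK gK cg]]] := hf.
split=> [|metX].
  (* In general all Lyapunov functions with increment vanishing at infinity are taken. *)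
  pose Ls := [set L : X -> R | lyapunov f L /\ vanishing (fun x =>
    L (f x) - L x)].
  have sLs : sufficient f Ls.
    apply: sufficient_separating; first by move=> L [].
    move=> x y /(vanishing_lyapunov_separates (R :=
      R) lcX scX hsX cf)[L [? ? ?]].
    by exists L.
  have vLs L : Ls L -> vanishing (fun x => L (f x) - L x) by case.
  exists (spectrum (lyapunov_algebra Ls)), (spectrum_in _); split.
  - exact: spectrum_lyapunov_compactification.
  - exact: (spectrum_homeomorphism_relation lcX scX hsX cf cg fK gK sLs vLs).
  - exact: (spectrum_boundary_fixed lcX scX hsX cf cg fK sLs vLs).
(* In the metrizable case a countable base reduces them to a countable sufficient family. *)
have [d [d_pos d_sym d_tri d_ge0 d_nbhs]] := metrizable_distance metX.
have [D DP] := sigma_compact_dense d_nbhs scX.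
have baseP x U (xU : nbhs x U) := rational_ball_base d_sym d_tri d_nbhs DP xU.
have [lam [sLs vlam]] := countable_sufficient (R := R) lcX scX hsX cf baseP.
have vLs L : range lam L -> vanishing (fun x => L (f x) - L x).
  by move=> [b _ <-]; exact: vlam.
exists (spectrum (lyapunov_algebra (range lam))), (spectrum_in _); split.
- exact: spectrum_lyapunov_compactification.
- exact: (spectrum_homeomorphism_relation lcX scX hsX cf cg fK gK sLs vLs).
- exact: (spectrum_boundary_fixed lcX scX hsX cf cg fK sLs vLs).
- exact: (lyapunov_algebra_metrizable lcX scX hsX metX sLs).
Qed.
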